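(* Assume that $\eta,\nu,\kappa$ satisfy, for all admissible phase values $s\in[0,1]$, $$0<\eta_{\min}\le\eta(s)\le\eta_{\max},\qquad 0\le\nu_{\min}\le\nu(s)\le\nu_{\max},\qquad 0<\kappa_{\min}\le\kappa(s)\le\kappa_{\max}.$$ Let $$(\vec v_h^{\,n},\tilde\pi_h^{\,n},\tilde\pi_h^{\,n-1},\varphi_h^{\,n},\vec\zeta_h^{\,n})\in\vec V_h\times Q_h^0\times Q_h^0\times V_h\times\vec W_h$$ be given, and define $\widehat\varphi_h^{\,n}:=\mathcal T(\varphi_h^{\,n})$. Then the subproblems of one time step of the fully discrete splitting scheme described in the context (Cahn–Hilliard step, auxiliary-field step, Navier–Stokes step and pressure correction, solved successively) admit unique solutions $$(\varphi_h^{\,n+1},\xi_h^{\,n+1})\in V_h\times V_h,\qquad \vec\zeta_h^{\,n+1}\in\vec W_h,\qquad \vec v_h^{\,n+1}\in\vec V_h,\qquad \tilde\pi_h^{\,n+1}\in Q_h^0.$$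
   Context: **Setting.** $\omega\subset\mathbb R^2$ is a bounded simply connected domain with $C^2$ boundary, $\mathcal T_h$ is a conforming triangulation of $\omega$, and $(\cdot,\cdot)$ is the $L^2(\omega)$ inner product (for scalars, vectors or matrices). $P_r(K)$ denotes the scalar polynomials of total degree at most $r$ on the triangle $K$. Define $$V_h=\{\vartheta_h\in C^0(\overline\omega):\vartheta_h|_K\in P_2(K)\ \forall K\in\mathcal T_h\},\quad Q_h=\{q_h\in C^0(\overline\omega):q_h|_K\in P_1(K)\ \forall K\in\mathcal T_h\},$$ $$Q_h^0=\Big\{q_h\in Q_h:\int_\omega q_h\,dx=0\Big\},\quad \vec V_h=\{\vec w_h\in[V_h]^2:\vec w_h=\vec0\text{ on }\partial\omega\},\quad \vec W_h=[V_h]^2.$$ The constants $\rho,\mathrm{Re},\lambda,\gamma,\tau,\epsilon>0$, the time step $\Delta t>0$ and the nudging parameters $\alpha_u,\alpha_\phi,\alpha_\psi\ge0$ are fixed. The functions $\eta,\nu,\kappa$ are in $C^1(\mathbb R)$ with derivatives bounded on bounded sets. $F\in C^2(\mathbb R)$ is a double-well potential, $f:=F'$, with $|f(s)|\le C_f(1+|s|^{q-1})$ and $F(s)\ge c_F|s|^q-C_F$ for all $s\in\mathbb R$ (for some $q\ge3$, $C_f,c_F>0$, $C_F\ge0$). $I_H$ is a linear observation operator (applied componentwise to vectors), mapping sufficiently regular fields on $\omega$ into an observation space, with $\|w-I_Hw\|_{L^2(\omega)}^2\le\frac14c_0^2\,\delta^4\|w\|_{H^2(\omega)}^2$ for all $w\in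 H^2(\omega)$, where $\delta>0$ is the observational resolution and $c_0>0$ is independent of $\delta$. The fields $\vec u^{\,n},\phi^n,\vec\psi^{\,n}$ are the reference (observed) velocity, phase and auxiliary field at time $t^n=n\Delta t$; they enter only through the given data $I_H(\phi^n-\varphi_h^{\,n})$, $I_H(\vec\psi^{\,n}-\vec\zeta_h^{\,n})$, $I_H(\vec u^{\,n}-\vec v_h^{\,n})$, which are elements of $L^2(\omega)$ (resp. $L^2(\omega)^2$). Truncation: $\mathcal T(s):=\min\{1,\max\{0,s\}\}$ for $s\in\mathbb R$, and $\widehat\varphi_h^{\,m}:=\mathcal T(\varphi_h^{\,m})$ pointwise, for $m=n,n+1$. Transport forms: for $\vec a\in\vec V_h$, $r,s\in V_h$, $\vec z,\vec\theta\in\vec W_h$, $\vec b,\vec w\in\vec V_h$, $$b_\phi(\vec a;r,s)=-(r\vec a,\nabla s)-\tfrac12((\nabla\cdot\vec a)r,s),$$ $$b_\psi(\vec a;\vec z,\vec\theta)=((\vec a\cdot\nabla)\vec z,\vec\theta)+\tfrac12((\nabla\cdot\vec a)\vec z,\vec\theta),\qquad c(\vec a;\vec b,\vec w)=((\vec a\cdot\nabla)\vec b,\vec w)+\tfrac12((\nabla\cdot\vec a)\vec b,\vec w).$$ Convention: $(\nabla\vec a)_{kj}=\partial_ja_k$. **One time step of the scheme.** (i) Cahn–Hilliard step: find $(\varphi_h^{\,n+1},\xi_h^{\,n+1})\in V_h\times V_h$ such that for all $(\vartheta_h,\chi_h)\in V_h\times V_h$ $$\Big(\tfrac{\varphi_h^{\,n+1}-\varphi_h^{\,n}}{\Delta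 t},\vartheta_h\Big)+b_\phi(\vec v_h^{\,n};\varphi_h^{\,n+1},\vartheta_h)+\tau(\nabla\xi_h^{\,n+1},\nabla\vartheta_h)=(\alpha_\phi I_H(\phi^n-\varphi_h^{\,n}),\vartheta_h),$$ $$(\xi_h^{\,n+1},\chi_h)-\lambda(\nabla\varphi_h^{\,n+1},\nabla\chi_h)=\lambda\gamma(f(\widehat\varphi_h^{\,n}),\chi_h)+\tfrac12(\nu'(\widehat\varphi_h^{\,n})|\nabla\vec\zeta_h^{\,n}|^2,\chi_h).$$ (ii) Auxiliary-field step: find $\vec\zeta_h^{\,n+1}\in\vec W_h$ such that for all $\vec\theta_h\in\vec W_h$ $$\Big(\tfrac{\vec\zeta_h^{\,n+1}-\vec\zeta_h^{\,n}}{\Delta t},\vec\theta_h\Big)+b_\psi(\vec v_h^{\,n};\vec\zeta_h^{\,n+1},\vec\theta_h)+\epsilon(\nu(\widehat\varphi_h^{\,n+1})\nabla\vec\zeta_h^{\,n+1},\nabla\vec\theta_h)=(\alpha_\psi I_H(\vec\psi^{\,n}-\vec\zeta_h^{\,n}),\vec\theta_h).$$ (iii) Navier–Stokes step and pressure correction: find $\vec v_h^{\,n+1}\in\vec V_h$ such that for all $\vec w_h\in\vec V_h$ $$\begin{aligned}&\Big(\tfrac{\rho\mathrm{Re}}{\Delta t}\vec v_h^{\,n+1},\vec w_h\Big)+\rho\mathrm{Re}\,c(\vec v_h^{\,n};\vec v_h^{\,n+1},\vec w_h)+(\eta(\widehat\varphi_h^{\,n+1})\nabla\vec v_h^{\,n+1},\nabla\vec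 w_h)+\Big(\tfrac{\eta(\widehat\varphi_h^{\,n+1})}{\kappa(\widehat\varphi_h^{\,n+1})}(1-\widehat\varphi_h^{\,n+1})\vec v_h^{\,n+1},\vec w_h\Big)\\&=\Big(\tfrac{\rho\mathrm{Re}}{\Delta t}\vec v_h^{\,n},\vec w_h\Big)+(2\tilde\pi_h^{\,n}-\tilde\pi_h^{\,n-1},\nabla\cdot\vec w_h)+(\xi_h^{\,n+1}\nabla\varphi_h^{\,n+1},\vec w_h)-\tfrac12(\nu'(\widehat\varphi_h^{\,n+1})|\nabla\vec\zeta_h^{\,n+1}|^2\nabla\varphi_h^{\,n+1},\vec w_h)\\&\quad-(\nu(\widehat\varphi_h^{\,n+1})(\nabla\vec\zeta_h^{\,n+1})^T\nabla\vec\zeta_h^{\,n+1},\nabla\vec w_h)+(\alpha_uI_H(\vec u^{\,n}-\vec v_h^{\,n}),\vec w_h);\end{aligned}$$ then find $\tilde\pi_h^{\,n+1}\in Q_h^0$ such that for all $q_h\in Q_h^0$ $$(\nabla\tilde\pi_h^{\,n+1},\nabla q_h)=\Big(\tfrac{\rho\mathrm{Re}}{\Delta t}\nabla\cdot\vec v_h^{\,n+1},q_h\Big)-(\nabla\tilde\pi_h^{\,n},\nabla q_h).$$ *)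

(* Defs.v *)
From HB Require Import structures.
From mathcomp Require Import all_boot all_order all_algebra.
From mathcomp Require Import all_classical all_reals all_analysis.

Set Implicit Arguments.
Unset Strict Implicit.
Unset Printing Implicit Defensive.

Import Order.TTheory GRing.Theory Num.Theory.
Import numFieldNormedType.Exports.

Local Open Scope classical_set_scope.
Local Open Scope ring_scope.

Section PlaneCalculus.
Context {R : realType}.
Implicit Types (omega U A : set (R * R)) (f g w : R * R -> R).

Definition area := (@lebesgue_measure R \x @lebesgue_measure R)%E.

Definition e_ (j : 'I_2) : R * R := if j == 0 then (1, 0) else (0, 1).

Definition partial (j : 'I_2) f : R * R -> R := fun x => 'D_(e_ j) f x.

Definition grad f : R * R -> 'cV[R]_2 := fun x => \col_j partial j f x.

(* (Grad a)_{kj} = d_j a_k *)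
Definition Grad (a : R * R -> 'cV[R]_2) : R * R -> 'M[R]_2 :=
  fun x => \matrix_(k, j) partial j (fun y => a y k 0) x.

Definition div (a : R * R -> 'cV[R]_2) : R * R -> R := fun x => \tr (Grad a x).

(* L2(omega) products.  The second one serves both columns ('cV_2 = 'M_(2, 1))
   and 2 x 2 matrices; [dot] is the Frobenius product. *)
Definition dot m n (A B : 'M[R]_(m, n)) : R := \sum_i \sum_j A i j * B i j.

Definition ips omega f g : R := \int[area]_(x in omega) (f x * g x).

Definition ip omega m n (A B : R * R -> 'M[R]_(m, n)) : R :=
  \int[area]_(x in omega) dot (A x) (B x).

Definition frontier A : set (R * R) := closure A `\` interior A.

(* f is C^k on the open set U *)
Fixpoint Ck (k : nat) U f : Prop :=
  (forall x, U x -> {for x, continuous f}) /\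
  if k is k'.+1 then
    forall j, (forall x, U x -> derivable f x (e_ j)) /\ Ck k' U (partial j f)
  else True.

(* Every loop in A contracts within A, with its base point fixed. *)
Definition loops_contractible A : Prop :=
  forall c : R -> R * R,
    {within `[0, 1], continuous c} ->
    (forall t, t \in `[0, 1] -> A (c t)) -> c 0 = c 1 ->
  exists H : R * R -> R * R,
    [/\ {within `[0, 1] `*` `[0, 1], continuous H},
        forall s t, s \in `[0, 1] -> t \in `[0, 1] -> A (H (s, t)),
        forall t, t \in `[0, 1] -> H (0, t) = c t,
        forall t, t \in `[0, 1] -> H (1, t) = c 0 &
        forall s, s \in `[0, 1] -> H (s, 0) = c 0 /\ H (s, 1) = c 0].

Definition bounded_simply_connected_domain omega : Prop :=
  [/\ bounded_set omega, open omega, omega !=set0, connected omega &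
      loops_contractible omega].

(* Near each boundary point, omega is the sublevel set of a C^2 function
   without critical points. *)
Definition C2_boundary omega : Prop :=
  forall x, frontier omega x ->
  exists (U : set (R * R)) (g : R * R -> R),
    [/\ open U, U x, Ck 2 U g, forall y, U y -> grad g y != 0 &
        omega `&` U = [set y | U y /\ g y < 0]].

Definition L2 omega f : Prop :=
  measurable_fun omega f /\
  area.-integrable omega (fun x => (f x ^+ 2)%:E).

Definition L2v omega (a : R * R -> 'cV[R]_2) : Prop :=
  forall k, L2 omega (fun x => a x k 0).

Definition test_function omega f : Prop :=
  (forall k, Ck k setT f) /\
  exists C : set (R * R),
    [/\ compact C, C `<=` omega & forall x, ~ C x -> f x = 0].

Definition weak_partial omega (j : 'I_2) w g : Prop :=
  forall p, test_function omega p ->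
    ips omega w (partial j p) = - ips omega g p.

(* w is in H^2(omega), with weak first and second derivatives g and h *)
Definition H2_with omega w (g : 'I_2 -> R * R -> R)
    (h : 'I_2 -> 'I_2 -> R * R -> R) : Prop :=
  [/\ L2 omega w,
      forall j, L2 omega (g j) /\ weak_partial omega j w (g j) &
      forall j k, L2 omega (h j k) /\ weak_partial omega k (g j) (h j k)].

Definition H2_norm_sqr omega w (g : 'I_2 -> R * R -> R)
    (h : 'I_2 -> 'I_2 -> R * R -> R) : R :=
  ips omega w w + \sum_j ips omega (g j) (g j) +
  \sum_(j < 2) \sum_(k < 2 | (j <= k)%N) ips omega (h j k) (h j k).

(* An operator acting on the fields in [dom] (a linear space of "sufficiently
   regular" fields containing H^2).  Fields are almost-everywhere classes,
   hence linearity is required almost everywhere on omega. *)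
Definition observation_operator omega (c0 delta : R)
    (dom : set (R * R -> R)) (IH : (R * R -> R) -> R * R -> R) : Prop :=
  [/\ forall a w w', dom w -> dom w' -> dom (fun x => a * w x + w' x),
      forall a w w', dom w -> dom w' ->
        {ae area, forall x, omega x ->
           IH (fun y => a * w y + w' y) x = a * IH w x + IH w' x} &
      forall w (g : 'I_2 -> R * R -> R) (h : 'I_2 -> 'I_2 -> R * R -> R),
        H2_with omega w g h ->
        [/\ dom w, L2 omega (IH w) &
            ips omega (fun x => w x - IH w x) (fun x => w x - IH w x) <=
            4^-1 * c0 ^+ 2 * delta ^+ 4 * H2_norm_sqr omega w g h]].

Definition IHv (IH : (R * R -> R) -> R * R -> R) (a : R * R -> 'cV[R]_2) :
    R * R -> 'cV[R]_2 :=
  fun x => \col_k IH (fun y => a y k 0) x.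

End PlaneCalculus.

Section Mesh.
Context {R : realType}.
Implicit Types (omega : set (R * R)) (Phi : R * R -> R * R).

Definition bary (k : 'I_3) (x : R * R) : R :=
  if k == 0 then 1 - x.1 - x.2 else if k == 1 then x.1 else x.2.

Definition ref_triangle : set (R * R) := [set x | forall k, 0 <= bary k x].

Definition ref_vertex (k : 'I_3) : R * R :=
  if k == 0 then (0, 0) else if k == 1 then (1, 0) else (0, 1).

(* A triangle is given by a parametrization Phi over the reference triangle.
   Sides are numbered by the opposite vertex. *)
Definition cell Phi : set (R * R) := Phi @` ref_triangle.

Definition vertex Phi (k : 'I_3) : R * R := Phi (ref_vertex k).

Definition side Phi (k : 'I_3) : set (R * R) :=
  Phi @` (ref_triangle `&` [set x | bary k x = 0]).

Definition segment (a b : R * R) : set (R * R) :=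
  [set (1 - t) *: a + t *: b | t in `[0, 1]].

(* A triangle of a mesh of omega; only sides lying on the boundary of omega
   may be curved.  The last condition is automatic for straight triangles, and
   for arcs of a C^2 boundary. *)
Definition mesh_triangle omega Phi : Prop :=
  [/\ {within ref_triangle, continuous Phi},
      {in ref_triangle &, injective Phi},
      forall k, side Phi k `<=` frontier omega \/
                exists a b, side Phi k = segment a b &
      area.-negligible (frontier (cell Phi))].

Definition straight_triangle Phi : Prop :=
  forall x, ref_triangle x -> Phi x = \sum_k bary k x *: vertex Phi k.

Definition conforming_triangulation omega (N : nat)
    (T : 'I_N -> R * R -> R * R) : Prop :=
  [/\ forall i, mesh_triangle omega (T i),
      closure omega = \bigcup_i cell (T i) &
      forall i j, i != j ->
        [\/ cell (T i) `&` cell (T j) = set0,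
            exists a b, cell (T i) `&` cell (T j) = [set vertex (T i) a] /\
                        vertex (T i) a = vertex (T j) b |
            exists a b, cell (T i) `&` cell (T j) = side (T i) a /\
                        side (T i) a = side (T j) b]].

(* A C^2 domain is not a finite union of straight triangles: either the
   boundary is C^2 (and boundary triangles have curved sides), or the mesh
   consists of straight triangles (and omega is the polygon they fill). *)
Definition boundary_assumption omega (N : nat)
    (T : 'I_N -> R * R -> R * R) : Prop :=
  C2_boundary omega \/ forall i, straight_triangle (T i).

Definition poly_on (r : nat) (K : set (R * R)) (f : R * R -> R) : Prop :=
  exists c : nat -> nat -> R, forall x, K x ->
    f x = \sum_(i < r.+1) \sum_(j < r.+1 | (i + j <= r)%N)
            c i j * x.1 ^+ i * x.2 ^+ j.

(* Functions on the closure of omega are represented by their extension by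
   zero, so that equality of functions is equality on the closure. *)
Definition fe_space (r : nat) omega (N : nat) (T : 'I_N -> R * R -> R * R) :
    set (R * R -> R) :=
  [set f | [/\ {within closure omega, continuous f},
               forall i, poly_on r (cell (T i)) f &
               forall x, ~ closure omega x -> f x = 0]].

End Mesh.

Section Spaces.
Context {R : realType} (omega : set (R * R)) (N : nat)
  (T : 'I_N -> R * R -> R * R).

Definition Vh : set (R * R -> R) := fe_space 2 omega T.

Definition Qh : set (R * R -> R) := fe_space 1 omega T.

Definition Qh0 : set (R * R -> R) :=
  [set q | Qh q /\ \int[area]_(x in omega) q x = 0].

Definition Wvec : set (R * R -> 'cV[R]_2) :=
  [set w | forall k, Vh (fun x => w x k 0)].

Definition Vvec : set (R * R -> 'cV[R]_2) :=
  [set w | Wvec w /\ forall x, frontier omega x -> w x = 0].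

End Spaces.

Section Coefficients.
Context {R : realType}.

Definition C1_line (g : R -> R) : Prop :=
  (forall s, derivable g s 1) /\ continuous (derive1 g).

Definition coefficient (g : R -> R) : Prop :=
  C1_line g /\
  forall M : R, exists B : R, forall s, `|s| <= M -> `|derive1 g s| <= B.

(* two local minima separated by a barrier *)
Definition double_well (F : R -> R) : Prop :=
  exists a b c : R,
    [/\ a < b < c, F a < F b, F c < F b,
        \forall s \near a, F a <= F s & \forall s \near c, F c <= F s].

Definition potential (F : R -> R) (q Cf cF CF : R) : Prop :=
  [/\ (forall s, derivable F s 1) /\ C1_line (derive1 F),
      double_well F,
      forall s, `|derive1 F s| <= Cf * (1 + `|s| `^ (q - 1)) &
      forall s, cF * `|s| `^ q - CF <= F s].

Definition truncation (s : R) : R := Num.min 1 (Num.max 0 s).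

End Coefficients.

Record parameters (R : realType) := MkParameters {
  prm_rho : R; prm_Reynolds : R; prm_lambda : R; prm_gamma : R;
  prm_tau : R; prm_epsilon : R; prm_dt : R;
  prm_alpha_u : R; prm_alpha_phi : R; prm_alpha_psi : R;
  prm_eta : R -> R; prm_nu : R -> R; prm_kappa : R -> R; prm_F : R -> R }.

Definition admissible_parameters (R : realType) (P : parameters R) : Prop :=
  [/\ [/\ 0 < prm_rho P, 0 < prm_Reynolds P, 0 < prm_lambda P &
          0 < prm_gamma P],
      [/\ 0 < prm_tau P, 0 < prm_epsilon P & 0 < prm_dt P],
      [/\ 0 <= prm_alpha_u P, 0 <= prm_alpha_phi P & 0 <= prm_alpha_psi P] &
      [/\ coefficient (prm_eta P), coefficient (prm_nu P) &
          coefficient (prm_kappa P)]].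

Section Scheme.
Context {R : realType} (omega : set (R * R)) (N : nat)
  (T : 'I_N -> R * R -> R * R) (P : parameters R).
Local Notation scalar := (R * R -> R).
Local Notation vector := (R * R -> 'cV[R]_2).
Local Notation V := (Vh omega T).
Local Notation Q0 := (Qh0 omega T).
Local Notation VV := (Vvec omega T).
Local Notation WW := (Wvec omega T).

Definition b_phi (a : vector) (r s : scalar) : R :=
  - ip omega (fun x => r x *: a x) (grad s)
  - 2^-1 * ips omega (fun x => div a x * r x) s.

(* (a . grad) z = Grad z *m a.  This form is both b_psi and c. *)
Definition transport (a z theta : vector) : R :=
  ip omega (fun x => Grad z x *m a x) theta
  + 2^-1 * ip omega (fun x => div a x *: z x) theta.

Definition hat (phi : scalar) : scalar := fun x => truncation (phi x).

Definition normsq_Grad (zeta : vector) : scalar :=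
  fun x => dot (Grad zeta x) (Grad zeta x).

(* In the three steps, obs_phi, obs_psi and obs_u are the observations
   I_H (phi^n - phi_h^n), I_H (psi^n - zeta_h^n) and I_H (u^n - v_h^n). *)
Definition CH_solution (v : vector) (phi : scalar) (zeta : vector)
    (obs_phi : scalar) (sol : scalar * scalar) : Prop :=
  let: (phi1, xi1) := sol in
  [/\ V phi1, V xi1 &
  forall vartheta chi, V vartheta -> V chi ->
    ips omega (fun x => (phi1 x - phi x) / prm_dt P) vartheta
      + b_phi v phi1 vartheta
      + prm_tau P * ip omega (grad xi1) (grad vartheta)
    = ips omega (fun x => prm_alpha_phi P * obs_phi x) vartheta
    /\
    ips omega xi1 chi - prm_lambda P * ip omega (grad phi1) (grad chi)
    = prm_lambda P * prm_gamma P *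
        ips omega (fun x => derive1 (prm_F P) (hat phi x)) chi
      + 2^-1 * ips omega
          (fun x => derive1 (prm_nu P) (hat phi x) * normsq_Grad zeta x) chi].

Definition aux_solution (v zeta obs_psi : vector) (phi1 : scalar)
    (zeta1 : vector) : Prop :=
  WW zeta1 /\
  forall theta, WW theta ->
    ip omega (fun x => (prm_dt P)^-1 *: (zeta1 x - zeta x)) theta
      + transport v zeta1 theta
      + prm_epsilon P *
        ip omega (fun x => prm_nu P (hat phi1 x) *: Grad zeta1 x) (Grad theta)
    = ip omega (fun x => prm_alpha_psi P *: obs_psi x) theta.

(* pi and pi_ are the pressures at the times n and n - 1. *)
Definition NS_solution (v : vector) (pi pi_ : scalar) (obs_u : vector)
    (phi1 xi1 : scalar) (zeta1 v1 : vector) : Prop :=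
  VV v1 /\
  forall w, VV w ->
    ip omega (fun x => (prm_rho P * prm_Reynolds P / prm_dt P) *: v1 x) w
      + prm_rho P * prm_Reynolds P * transport v v1 w
      + ip omega (fun x => prm_eta P (hat phi1 x) *: Grad v1 x) (Grad w)
      + ip omega (fun x => (prm_eta P (hat phi1 x) / prm_kappa P (hat phi1 x)
                            * (1 - hat phi1 x)) *: v1 x) w
    = ip omega (fun x => (prm_rho P * prm_Reynolds P / prm_dt P) *: v x) w
      + ips omega (fun x => 2 * pi x - pi_ x) (div w)
      + ip omega (fun x => xi1 x *: grad phi1 x) w
      - 2^-1 * ip omega (fun x => (derive1 (prm_nu P) (hat phi1 x)
                            * normsq_Grad zeta1 x) *: grad phi1 x) w
      - ip omega (fun x => prm_nu P (hat phi1 x)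
                            *: ((Grad zeta1 x)^T *m Grad zeta1 x)) (Grad w)
      + ip omega (fun x => prm_alpha_u P *: obs_u x) w.

Definition pressure_solution (pi : scalar) (v1 : vector) (pi1 : scalar) :
    Prop :=
  Q0 pi1 /\
  forall q, Q0 q ->
    ip omega (grad pi1) (grad q)
    = ips omega (fun x => prm_rho P * prm_Reynolds P / prm_dt P * div v1 x) q
      - ip omega (grad pi) (grad q).

End Scheme.

(* Main.v *)
Require Import Defs.
From HB Require Import structures.
From mathcomp Require Import all_boot all_order all_algebra.
From mathcomp Require Import all_classical all_reals all_analysis.
From mathcomp Require Import measurable_realfun ring lra.

Set Implicit Arguments.
Unset Strict Implicit.
Unset Printing Implicit Defensive.

Import Order.TTheory GRing.Theory Num.Theory.
Import numFieldNormedType.Exports.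

Local Open Scope classical_set_scope.
Local Open Scope ring_scope.

(** Each of the four subproblems is a square linear system: the unknown and the
    test function range over the same finite-dimensional space, and the equation
    has the form [B x y = l y] with [B] bilinear and [l] linear. Existence and
    uniqueness both follow once [B] has a trivial kernel
    ([variational_problem_wellposed]), and this is an energy estimate: the
    homogeneous equation is tested with its own solution. The transport forms
    then vanish, because [2 * r * (v . grad r) + (div v) * r ^ 2] is the
    divergence of [r ^ 2 v] and [v] is zero on the boundary
    ([transport_skew]). What is left is a vanishing sum of nonnegative terms:
    - Cahn-Hilliard: eliminating [(grad phi, grad xi)] between the two equations
      leaves [|phi|^2 / dt + (tau / lambda) |xi|^2 = 0];
    - auxiliary field: [|zeta|^2 / dt] and the diffusion, of weight [nu >= 0];
    - Navier-Stokes: the mass, viscous and Darcy terms, the last of weight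
      [(eta / kappa) (1 - phi) >= 0] thanks to the truncation;
    - pressure: the gradient vanishes, so the pressure is constant on the
      connected domain, and its mean is zero ([fe1_grad_eq0_cst]).

    Derivatives of finite element functions exist off the skeleton, the union of
    the frontiers of the cells, which is closed and null. Integrals may be
    restricted to its complement ([Rintegral_off_skeleton]), an open set on which
    the integrands are bounded and continuous; an element of the space that
    vanishes there vanishes everywhere ([fe_eq0]).

    The divergence theorem has to hold for cells with sides curved along the
    boundary. It is obtained without traces. Extended by zero, a component [g]
    of [r ^ 2 v] is a polynomial on each of finitely many closed sets covering
    the plane (the cells) or zero (the complement of the domain), hence it is
    Lipschitz ([lipschitz_pasting]). Its difference quotients have mean zero,
    since the area is invariant under translations, so the integral of a partial
    derivative over the plane is zero by dominated convergence
    ([integral_derive_eq0]). Second difference quotients of [|g|] show in the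
    same way that the zeros of [g], in particular the points outside the domain,
    contribute nothing to that integral ([integral_derive_zeros]). *)

(** * Uniquely solvable variational problems in finite dimension *)

Section Galerkin.
Context {K : fieldType} {E : lmodType K}.
Implicit Types (X : set E) (l : E -> K) (B : E -> E -> K).

Definition subspace_of X : Prop :=
  X 0 /\ forall a x y, X x -> X y -> X (a *: x + y).

(** Only an inclusion: the spanning family may lie outside [X], so that the
    property passes to subsets. *)
Definition finitely_spanned X : Prop :=
  exists (I : finType) (g : I -> E),
    forall x, X x -> exists c : I -> K, x = \sum_i c i *: g i.

(** Linearity is asked on [X] only: elsewhere, derivatives and integrals may
    take default values, which do not add up. *)
Definition linear_on X l : Prop :=
  forall a x y, X x -> X y -> l (a *: x + y) = a * l x + l y.

Definition bilinear_on X B : Prop :=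
  (forall y, X y -> linear_on X (B^~ y)) /\ (forall x, X x -> linear_on X (B x)).

Definition independent n (e : 'I_n -> E) : Prop :=
  forall c : 'rV[K]_n, \sum_i c 0 i *: e i = 0 -> c = 0.

Lemma linear_on0 X l : subspace_of X -> linear_on X l -> l 0 = 0.
Proof.
move=> [X0 _] ll; have := ll 1 0 0 X0 X0.
by rewrite scaler0 addr0 mul1r => /eqP; rewrite -subr_eq0 opprD addNKr oppr_eq0 => /eqP.
Qed.

Lemma linear_onZ X l a x : subspace_of X -> linear_on X l -> X x ->
  l (a *: x) = a * l x.
Proof.
move=> sX ll Xx; have := ll a x 0 Xx sX.1.
by rewrite (linear_on0 sX ll) !addr0.
Qed.

Lemma subspace_sum X n (e : 'I_n -> E) (c : 'rV[K]_n) :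
  subspace_of X -> (forall i, X (e i)) -> X (\sum_i c 0 i *: e i).
Proof.
move=> [X0 XD] Xe.
by elim/big_ind : _ => // [x y Xx Xy|i _];
  [have := XD 1 x y Xx Xy; rewrite scale1r|have := XD (c 0 i) _ _ (Xe i) X0; rewrite addr0].
Qed.

Lemma linear_on_sum X l n (e : 'I_n -> E) (c : 'rV[K]_n) :
  subspace_of X -> linear_on X l -> (forall i, X (e i)) ->
  l (\sum_i c 0 i *: e i) = \sum_i c 0 i * l (e i).
Proof.
move=> sX ll Xe.
suff: X (\sum_i c 0 i *: e i) /\
  l (\sum_i c 0 i *: e i) = \sum_i c 0 i * l (e i) by case.
have [X0 XD] := sX.
elim/big_rec2 : _ => [|i y1 y2 _ [Xy2 <-]].
  by split=> //; exact: (linear_on0 sX ll).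
by split; [exact: XD | exact: ll].
Qed.

Lemma independent_size m (g : 'I_m -> E) n (e : 'I_n -> E) :
  (forall i, exists c : 'rV[K]_m, e i = \sum_j c 0 j *: g j) ->
  independent e -> (n <= m)%N.
Proof.
move=> /choice[c ec] ie; pose M := \matrix_(i < n, j < m) c i 0 j.
suff fM : row_free M by rewrite -(eqP fM) rank_leq_col.
apply/row_freeP; apply: contrapT => nM.
have : kermx M != 0.
  by apply: contra_notN nM; rewrite kermx_eq0 => /row_freeP.
move=> /rowV0Pn[u /sub_kermxP uM] /negP[]; apply/eqP/ie.
transitivity (\sum_j (u *m M) 0 j *: g j); last first.
  by rewrite uM big1// => j _; rewrite mxE scale0r.
under eq_bigr do rewrite ec scaler_sumr.
rewrite exchange_big/=; apply: eq_bigr => j _.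
rewrite mxE scaler_suml; apply: eq_bigr => i _.
by rewrite mxE scalerA.
Qed.

(** An independent family in [X] has at most as many members as the spanning
    family, so there is a longest one; by maximality it spans [X]. *)
Lemma finitely_spanned_basis X : subspace_of X -> finitely_spanned X ->
  exists n (e : 'I_n -> E), [/\ forall i, X (e i), independent e &
    forall x, X x -> exists c : 'rV[K]_n, x = \sum_i c 0 i *: e i].
Proof.
move=> sX [I [g Xg]].
pose P n := `[< exists e : 'I_n -> E, (forall i, X (e i)) /\ independent e >].
have P0 : exists n, P n.
  exists 0%N; apply/asboolP; exists (fun=> 0); split; first by case.
  by move=> c _; apply/rowP => -[].
have Pm n : P n -> (n <= #|I|)%N.
  move=> /asboolP[e [Xe ie]].
  apply: (@independent_size _ (g \o enum_val) _ e) => // i.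
  have [c ->] := Xg _ (Xe i); exists (\row_j c (enum_val j)).
  rewrite (reindex (@enum_val _ I)).
    by apply: eq_bigr => j _; rewrite mxE.
  by exists enum_rank => x _; rewrite ?enum_valK ?enum_rankK.
case: (ex_maxnP P0 Pm) => n /asboolP[e [Xe ie]] nmax.
exists n, e; split=> // x Xx.
pose e' (i : 'I_n.+1) := if unlift ord0 i is Some j then e j else x.
have e'0 : e' ord0 = x by rewrite /e' unlift_none.
have e'l i : e' (lift ord0 i) = e i by rewrite /e' liftK.
have nie' : ~ independent e'.
  move=> ie'; suff : P n.+1 by move/nmax; rewrite ltnn.
  apply/asboolP; exists e'; split=> // i; rewrite /e'.
  by case: (unliftP ord0 i) => [j _|_].
have [c [ce /eqP c0]] : exists c : 'rV[K]_n.+1, \sum_i c 0 i *: e' i = 0 /\ c <> 0.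
  apply: contrapT => h; apply: nie' => c ce; apply: contrapT => c0.
  by apply: h; exists c.
move: ce; rewrite big_ord_recl e'0.
under eq_bigr do rewrite e'l.
have [c00|c00] := eqVneq (c 0 ord0) 0.
  rewrite c00 scale0r add0r => ce.
  have : \row_i c 0 (lift ord0 i) = 0.
    by apply: ie; rewrite -[RHS]ce; apply: eq_bigr => i _; rewrite mxE.
  move=> /rowP cl; move: c0 => /eqP[]; apply/rowP => i; rewrite mxE.
  by case: (unliftP ord0 i) => [j ->|->//]; have := cl j; rewrite !mxE.
move=> /eqP; rewrite addr_eq0 => /eqP cx.
exists (\row_i (- (c 0 ord0)^-1 * c 0 (lift ord0 i))).
under eq_bigr do rewrite mxE -scalerA.
by rewrite -scaler_sumr scaleNr -scalerN -cx scalerA mulVf// scale1r.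
Qed.

(** In a basis of [X] this is a square linear system with the matrix of [B], and
    a square matrix with trivial kernel is invertible. *)
Lemma variational_problem_wellposed X B l :
  subspace_of X -> finitely_spanned X -> bilinear_on X B -> linear_on X l ->
  (forall x, X x -> (forall y, X y -> B x y = 0) -> x = 0) ->
  exists! x, X x /\ forall y, X y -> B x y = l y.
Proof.
move=> sX fX [Bl Br] ll B0.
have [n [e [Xe ie Xspan]]] := finitely_spanned_basis sX fX.
pose A := \matrix_(i, j) B (e i) (e j).
have BE (c : 'rV[K]_n) j : B (\sum_i c 0 i *: e i) (e j) = (c *m A) 0 j.
  rewrite (linear_on_sum c sX (Bl _ (Xe j)) Xe) mxE.
  by apply: eq_bigr => i _; rewrite mxE.
have BX x (l' : E -> K) : X x -> linear_on X l' ->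
    (forall j, B x (e j) = l' (e j)) -> forall y, X y -> B x y = l' y.
  move=> Xx ll' Bj y /Xspan[c ->].
  rewrite (linear_on_sum c sX (Br _ Xx) Xe) (linear_on_sum c sX ll' Xe).
  by apply: eq_bigr => j _; rewrite Bj.
have uA : A \in unitmx.
  rewrite -row_free_unit -kermx_eq0; apply/rowV0P => c /sub_kermxP cA.
  apply: ie; apply: B0; first exact: subspace_sum.
  apply: (BX _ (fun=> 0)) => [||j]; first exact: subspace_sum.
    by move=> a x y _ _; rewrite mulr0 addr0.
  by rewrite BE cA mxE.
pose c := (\row_j l (e j)) *m invmx A.
exists (\sum_i c 0 i *: e i); split.
  split; first exact: subspace_sum.
  apply: BX => //; first exact: subspace_sum.
  by move=> j; rewrite BE /c -mulmxA mulVmx// mulmx1 mxE.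
set x0 := \sum_i _ => x [Xx xl].
have Xx0 : X x0 by exact: subspace_sum.
have x0l y : X y -> B x0 y = l y.
  by apply: BX => // j; rewrite BE /c -mulmxA mulVmx// mulmx1 mxE.
apply/eqP; rewrite -subr_eq0 addrC -scaleN1r; apply/eqP/B0.
  exact: sX.2.
by move=> y Xy; rewrite (Bl y Xy)// xl// x0l// mulN1r addNr.
Qed.

Lemma finitely_spannedS X Y : X `<=` Y -> finitely_spanned Y -> finitely_spanned X.
Proof. by move=> XY [I [g Yg]]; exists I, g => x /XY; exact: Yg. Qed.

Lemma linear_onD X l l' : linear_on X l -> linear_on X l' ->
  linear_on X (fun y => l y + l' y).
Proof. by move=> ll ll' a x y Xx Xy; rewrite ll// ll'// mulrDr addrACA. Qed.

Lemma linear_onM X l c : linear_on X l -> linear_on X (fun y => c * l y).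
Proof. by move=> ll a x y Xx Xy; rewrite ll// mulrDr mulrCA. Qed.

Lemma linear_onN X l : linear_on X l -> linear_on X (fun y => - l y).
Proof. by move=> ll a x y Xx Xy; rewrite ll// opprD mulrN. Qed.

Lemma bilinear_onD X B B' : bilinear_on X B -> bilinear_on X B' ->
  bilinear_on X (fun x y => B x y + B' x y).
Proof.
move=> [Bl Br] [Bl' Br']; split=> [y Xy|x Xx].
  exact: linear_onD (Bl y Xy) (Bl' y Xy).
exact: linear_onD (Br x Xx) (Br' x Xx).
Qed.

Lemma bilinear_onM X B c : bilinear_on X B -> bilinear_on X (fun x y => c * B x y).
Proof.
move=> [Bl Br]; split=> [y Xy|x Xx].
  exact: linear_onM (Bl y Xy).
exact: linear_onM (Br x Xx).
Qed.

Lemma bilinear_onN X B : bilinear_on X B -> bilinear_on X (fun x y => - B x y).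
Proof.
move=> [Bl Br]; split=> [y Xy|x Xx].
  exact: linear_onN (Bl y Xy).
exact: linear_onN (Br x Xx).
Qed.

End Galerkin.

Lemma linear_on_comp (K : fieldType) (E F : lmodType K) (X : set E) (Y : set F)
    (phi : E -> F) (l : F -> K) :
  (forall x, X x -> Y (phi x)) -> (forall a x y, phi (a *: x + y) = a *: phi x + phi y) ->
  linear_on Y l -> linear_on X (fun x => l (phi x)).
Proof. by move=> XY lphi ll a x y Xx Xy; rewrite lphi ll//; exact: XY. Qed.

Lemma bilinear_on_comp (K : fieldType) (E F : lmodType K) (X : set E) (Y : set F)
    (phi psi : E -> F) (B : F -> F -> K) :
  (forall x, X x -> Y (phi x)) -> (forall a x y, phi (a *: x + y) = a *: phi x + phi y) ->
  (forall x, X x -> Y (psi x)) -> (forall a x y, psi (a *: x + y) = a *: psi x + psi y) ->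
  bilinear_on Y B -> bilinear_on X (fun x y => B (phi x) (psi y)).
Proof.
move=> XY lphi XY' lpsi [Bl Br]; split=> [y Xy|x Xx].
  exact: linear_on_comp XY lphi (Bl _ (XY' _ Xy)).
exact: linear_on_comp XY' lpsi (Br _ (XY _ Xx)).
Qed.

(** Serves for vector fields and for pairs, whose components range over [Y]. *)
Lemma finitely_spanned_images (K : fieldType) (F E : lmodType K) (m : finType)
    (phi : m -> F -> E) (Y : set F) (X : set E) :
  (forall k a x y, phi k (a *: x + y) = a *: phi k x + phi k y) ->
  finitely_spanned Y ->
  (forall x, X x -> exists2 y : m -> F, forall k, Y (y k) & x = \sum_k phi k (y k)) ->
  finitely_spanned X.
Proof.
move=> lphi [I [g Yg]] XY; exists (m * I)%type, (fun ki => phi ki.1 (g ki.2)) => x Xx.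
have [y Yy ->] := XY x Xx.
have phi0 k : phi k 0 = 0.
  by have /eqP := lphi k (- 1) 0 0; rewrite scaler0 addr0 scaleN1r addNr => /eqP.
have /choice[c yc] k := Yg _ (Yy k).
exists (fun ki => c ki.1 ki.2).
rewrite (eq_bigr (fun k => \sum_i c k i *: phi k (g i))); last first.
  move=> k _; rewrite yc; elim/big_rec2 : _ => [|i y1 y2 _ <-]; first exact: phi0.
  exact: lphi.
by rewrite pair_big.
Qed.


(** * The area of the plane *)

HB.instance Definition _ (R : realType) := Measure.on (@area R).

Section PlaneMeasure.
Context {R : realType}.
Local Notation plane := (measurableTypeR R * measurableTypeR R)%type.
Local Notation area := (@area R).
Implicit Types (A D N U : set plane).

Lemma ball_plane (x : R * R) e : ball x e = ball x.1 e `*` ball x.2 e.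
Proof. by []. Qed.

(** An open set is a countable union of squares with rational center and
    radius. *)
Lemma open_measurable_plane (U : set (R * R)) : open U -> measurable (U : set plane).
Proof.
move=> oU.
pose box (q : rat * rat * rat) : set plane :=
  ball (ratr q.1.1 : R) (ratr q.2) `*` ball (ratr q.1.2 : R) (ratr q.2).
pose F q : set plane := if `[< box q `<=` U >] then box q else set0.
have mF q : measurable (F q).
  rewrite /F; case: ifP => _; last exact: measurable0.
  by apply: measurableX; exact: measurable_ball.
suff -> : (U : set plane) = \bigcup_q F q.
  by apply: countable_bigcupT_measurable => //; exact: countableP.
apply/seteqP; split=> [x Ux|x [q _]]; last first.
  by rewrite /F; case: ifP => // /asboolP + ?; exact.
have [e e0 xeU] : exists2 e : R, 0 < e & ball x e `<=` U.
  by move: oU; rewrite openE => /(_ _ Ux)/nbhs_ballP[e /= e0 xe]; exists e.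
have near_rat (y : R) r : 0 < r -> exists q : rat, ball y r (ratr q).
  move=> r0; have /rat_in_itvoo[q] : y - r < y + r by rewrite ltrBlDr -addrA ltrDl addr_gt0.
  by move=> /itvP qr; exists q; rewrite ball_itv/= in_itv/= !qr.
have /rat_in_itvoo[r /itvP re] : 0 < e / 2 by rewrite divr_gt0.
have r0 : 0 < ratr r :> R by rewrite re.
have [q1 xq1] := near_rat x.1 _ r0; have [q2 xq2] := near_rat x.2 _ r0.
exists (q1, q2, r) => //; rewrite /F ifT; last first.
  apply/asboolP => y [/= y1 y2]; apply: xeU.
  have re2 : ratr r + ratr r <= e.
    by rewrite [leRHS]splitr lerD// ltW// re.
  by split; apply: (le_ball re2); [exact: ball_triangle y1|exact: ball_triangle y2].
by split; exact: ball_sym.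
Qed.

Lemma closed_measurable_plane (A : set (R * R)) :
  closed A -> measurable (A : set plane).
Proof.
by move=> /closed_openC/open_measurable_plane/measurableC; rewrite setCK.
Qed.

Lemma open_continuous_measurable_plane (D : set (R * R)) (f : R * R -> R) :
  open D -> (forall x, D x -> {for x, continuous f}) ->
  measurable_fun (D : set plane) f.
Proof.
move=> oD cf; apply: (measurability _ (RGenOpens.measurableE R)).
move=> _ [_ [a [b ->] <-]]; apply: open_measurable_plane.
rewrite openE => x [Dx fx]; rewrite /interior; apply: filterI.
  by move: oD; rewrite openE; apply.
by apply: (cf _ Dx); apply: open_nbhs_nbhs; split=> //; exact: interval_open.
Qed.

Lemma area_bounded_lt_pinfty (A : set (R * R)) :
  bounded_set A -> measurable (A : set plane) -> (area A < +oo)%E.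
Proof.
move=> [M [_ /(_ (`|M| + 1))]]; rewrite (le_lt_trans (ler_norm _) (ltr_pwDr _ _))// => /(_ isT).
set L := `|M| + 1 => AL mA.
have mI : measurable (`[- L, L] : set R) by exact: measurable_itv.
have AB : A `<=` `[- L, L] `*` `[- L, L].
  by move=> x /AL; rewrite /= prod_normE ge_max !in_itv/= !ler_norml => /andP[-> ->].
apply: (@le_lt_trans _ _ (area (`[- L, L] `*` `[- L, L]))).
  by apply: le_measure; rewrite ?inE//; exact: measurableX.
have lI : (lebesgue_measure (`[(- L)%R, L] : set R) < +oo)%E.
  by rewrite lebesgue_measure_itv/=; case: ifP => _; rewrite // ltry.
by rewrite /area product_measure1E// lte_mul_pinfty// ge0_fin_numE.
Qed.

Lemma area_open_gt0 (U : set (R * R)) : open U -> U !=set0 -> (0 < area U)%E.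
Proof.
move=> oU [x Ux].
have [e e0 xeU] : exists2 e : R, 0 < e & ball x e `<=` U.
  by move: oU; rewrite openE => /(_ _ Ux)/nbhs_ballP[e /= e0 xe]; exists e.
apply: (@lt_le_trans _ _ (area (ball x e))); last first.
  apply: le_measure; rewrite ?inE//; last exact: open_measurable_plane.
  by apply: open_measurable_plane; exact: ball_open.
have b0 (y : R) : (0 < lebesgue_measure (ball y e : set R))%E.
  by rewrite lebesgue_measure_ball ?ltW// lte_fin pmulrn_lgt0.
rewrite ball_plane /area product_measure1E; [|exact: measurable_ball..].
exact: mule_gt0 (b0 _) (b0 _).
Qed.

Lemma lebesgue_measure_preimage_shift (h : R) (A : set R) : measurable A ->
  lebesgue_measure ((fun x => x + h) @^-1` A) = lebesgue_measure A.
Proof.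
move=> mA.
have mh : measurable_fun [set: measurableTypeR R] ((fun x => x + h) : R -> measurableTypeR R).
  by apply: continuous_measurable_fun => x; apply: cvgD; [exact: cvg_id|exact: cvg_cst].
have := @lebesgue_measure_unique _
  (measure_function_pushforward__canonical__measure_function_Measure lebesgue_measure mh).
move=> E; apply: esym; apply: E => // _ [[a b] _ <-].
change (lebesgue_measure (`]a, b]%classic : set R) =
  lebesgue_measure ((fun x : R => x + h) @^-1` `]a, b]%classic)).
rewrite (_ : _ @^-1` _ = `]a - h, b - h]%classic); last first.
  by apply/seteqP; split=> x /=; rewrite !in_itv/= ltrBlDr lerBrDr.
by rewrite !lebesgue_measure_itv/= !lte_fin ltrD2r -!EFinB opprB addrA subrK.
Qed.

Lemma measurable_shift_plane (v : R * R) :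
  measurable_fun [set: plane] ((fun x => x + v) : plane -> plane).
Proof.
apply/measurable_fun_pairP; split.
  apply: (@measurableT_comp _ _ _ _ _ _ (fun x : R => x + v.1) _ fst) => //.
  by apply: continuous_measurable_fun => x; apply: cvgD; [exact: cvg_id|exact: cvg_cst].
apply: (@measurableT_comp _ _ _ _ _ _ (fun x : R => x + v.2) _ snd) => //.
by apply: continuous_measurable_fun => x; apply: cvgD; [exact: cvg_id|exact: cvg_cst].
Qed.

(** The image of the area under a translation is a measure that agrees with the
    area on rectangles. *)
Lemma area_preimage_shift (v : R * R) (A : set plane) : measurable A ->
  area ((fun x => x + v) @^-1` A) = area A.
Proof.
move=> mA; pose m' := measure_function_pushforward__canonical__measure_function_Measure
  area (measurable_shift_plane v).
apply: esym; apply: (@product_measure_unique _ _ _ _ _ _ _ m') => // B C mB mC.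
change (area ((fun x => x + v) @^-1` (B `*` C)) =
  (lebesgue_measure B * lebesgue_measure C)%E).
rewrite (_ : _ @^-1` _ = ((fun x => x + v.1) @^-1` B) `*` ((fun x => x + v.2) @^-1` C))//.
have mS (h : R) (D : set R) : measurable D -> measurable ((fun x => x + h) @^-1` D).
  move=> mD; rewrite -[X in measurable X]setTI.
  have := @continuous_measurable_fun R (fun x => x + h).
  by apply=> // x; apply: cvgD; [exact: cvg_id|exact: cvg_cst].
rewrite /area product_measure1E; [|exact: mS..].
by congr (_ * _)%E; exact: lebesgue_measure_preimage_shift.
Qed.

Lemma Rintegral_shift (g : R * R -> R) (v : R * R) :
  measurable_fun [set: plane] g ->
  area.-integrable [set: plane] (fun x => (g (x + v))%:E) ->
  \int[area]_x g (x + v) = \int[area]_x g x.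
Proof.
move=> mg ig; rewrite /Rintegral; congr fine.
transitivity (\int[pushforward area (fun x : plane => (x + v)%R : plane)]_x (g x)%:E)%E.
  rewrite integral_pushforward//; first exact: measurable_shift_plane.
  exact/measurable_EFinP.
pose m' := measure_function_pushforward__canonical__measure_function_Measure
  area (measurable_shift_plane v).
apply: (@eq_measure_integral _ _ _ _ area m') => A mA _.
exact: area_preimage_shift.
Qed.

Import HBNNSimple.

(** Also for a non-measurable integrand: the integral is a supremum of
    integrals of simple functions, and these do not see a null set. *)
Lemma integral_setD_null (D N : set plane) (f : plane -> \bar R) :
  measurable N -> area N = 0%E ->
  (\int[area]_(x in D) f x = \int[area]_(x in D `\` N) f x)%E.
Proof.
move=> mN N0; rewrite setDE setIC integral_mkcond [RHS]integral_mkcond patch_setI.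
move: (f \_ D)%E => g.
have key (h : plane -> \bar R) : (forall x, 0 <= h x)%E ->
    (\int[area]_x h x = \int[area]_x (h \_ (~` N)) x)%E.
  move=> h0; have h0' x : (0 <= (h \_ (~` N)) x)%E by rewrite patchE; case: ifP.
  rewrite !ge0_integralTE//; apply/eqP; rewrite eq_le; apply/andP; split.
    apply: ge_ereal_sup => y [k /= kh <-].
    have mCN : measurable (~` N) by exact: measurableC.
    apply: ereal_sup_ubound; exists (proj_nnsfun k mCN) => [x|].
      move: (congr1 (@^~ x) (mrestrict k mCN)) => /= <-.
      by rewrite !patchE; case: ifP.
    rewrite -mrestrict -integral_nnsfun// -setTD -ge0_negligible_integral//.
    - by rewrite integralT_nnsfun.
    - by apply/measurable_EFinP; exact: measurable_funPT.
    - by move=> x _; rewrite lee_fin.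
  apply: ge_ereal_sup => y [k /= kh <-].
  apply: ereal_sup_ubound; exists k => //= x; rewrite (le_trans (kh x))//.
  by rewrite patchE; case: ifP.
rewrite [LHS]integralE [RHS]integralE.
rewrite funepos_restrict funeneg_restrict.
by congr (_ - _)%E; apply: key => x; rewrite ?funepos_ge0 ?funeneg_ge0.
Qed.

End PlaneMeasure.

(** * Pasting Lipschitz functions along a closed cover *)

Section LipschitzPasting.
Context {R : realType} {I : finType}.

Lemma closure_finite_closed_cover (X : topologicalType) (C : I -> set X)
    (A : set X) (x : X) :
  (forall i, closed (C i)) -> A `<=` \bigcup_i C i -> closure A x ->
  exists i, C i x /\ closure (A `&` C i) x.
Proof.
move=> clC AC Ax; have [i ACx] : exists i, closure (A `&` C i) x.
  apply: contrapT => /forallNP nAC.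
  have /choice[B BP] i : exists B, nbhs x B /\ A `&` C i `&` B = set0.
    by have /existsNP[B /not_implyP[xB /nonemptyPn B0]] := nAC i; exists B.
  have /Ax[y [Ay By]] : nbhs x (\bigcap_(i in [set: I]) B i).
    have : \forall y \near x, forall i, B i y.
      by apply: filter_forall => i; exact: (BP i).1.
    by apply: filterS => y By i _; exact: By.
  have [i _ Ciy] := AC _ Ay.
  have : (A `&` C i `&` B i) y by split=> //; exact: By.
  by rewrite (BP i).2.
exists i; split=> //; apply: clC.
by apply: closureS ACx => y [].
Qed.

(** Let [s] be the supremum of the points up to which the bound from [a] holds.
    It is a limit of such points lying in one of the closed sets, hence belongs
    to this set, and the bound holds at [s]. If [s < b], then [s] is also a limit
    of points on its right that lie in one of the closed sets, and the bound
    would extend to them. *)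
Lemma lipschitz_pasting_line (f : R -> R) (C : I -> set R) (L a b : R) :
  (forall i, closed (C i)) -> `[a, b]%classic `<=` \bigcup_i C i ->
  (forall i x y, x \in `[a, b] -> y \in `[a, b] -> C i x -> C i y ->
     `|f x - f y| <= L * `|x - y|) ->
  a <= b -> `|f b - f a| <= L * (b - a).
Proof.
move=> clC abC Lf ab.
pose S := [set t | t \in `[a, b] /\ `|f t - f a| <= L * (t - a)].
have Sa : S a by split; rewrite ?bound_itvE// !subrr normr0 mulr0.
have ubS : ubound S b by move=> t [/[!in_itv]/= /andP[]].
have Sab : S `<=` `[a, b]%classic by move=> t [].
pose s := sup S.
have le_s t : S t -> t <= s by move=> St; apply: ub_le_sup => //; exists b.
have as_ : a <= s by exact: le_s.
have sb : s <= b by apply: ge_sup => //; exists a.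
have sab : s \in `[a, b] by rewrite in_itv/= as_.
have chain t u : a <= t -> t <= u -> `|f t - f a| <= L * (t - a) ->
    `|f u - f t| <= L * `|u - t| -> `|f u - f a| <= L * (u - a).
  move=> at_ tu Lt Lu; rewrite -(subrKA (f t)) (le_trans (ler_normD _ _))//.
  rewrite -[X in L * X](subrKA t) mulrDr lerD//.
  by rewrite (le_trans Lu)// ger0_norm ?subr_ge0.
have Ss : S s.
  split=> //.
  have [||i [Cis]] := @closure_finite_closed_cover _ C S s clC.
  - exact: subset_trans abC.
  - by apply: closure_sup; [exists a|exists b].
  move=> /(_ setT filterT)[t [[St Cit] _]]; have [tab Lt] := St.
  apply: (chain t) => //; [by move: tab; rewrite in_itv => /andP[]|exact: le_s|].
  exact: (Lf i).
have [<-|s_neq_b] := eqVneq s b; first by case: Ss.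
have s_lt_b : s < b by rewrite lt_neqAle s_neq_b.
have [||i [Cis]] := @closure_finite_closed_cover _ C `]s, b]%classic s clC.
- apply: subset_trans abC => t /=; rewrite !in_itv/= => /andP[st ->].
  by rewrite (le_trans as_)// ltW.
- move=> B /nbhs_ballP[e /= e0 sB].
  have m0 : 0 < Num.min (e / 2) (b - s) by rewrite lt_min divr_gt0// subr_gt0.
  exists (s + Num.min (e / 2) (b - s)); split.
    by rewrite /= in_itv/= ltrDl m0/= -lerBrDl ge_min lexx orbT.
  apply: sB; rewrite /ball/= opprD addNKr normrN gtr0_norm//.
  by rewrite gt_min ltr_pdivrMr// ltr_pMr// ltr1n.
move=> /(_ setT filterT)[t [[/= /[!in_itv]/= /andP[st tb] Cit] _]].
have tab : t \in `[a, b] by rewrite in_itv/= tb andbT (le_trans as_)// ltW.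
suff /le_s : S t by rewrite leNgt st.
split=> //; apply: (chain s) => //; [exact: ltW|by case: Ss|exact: (Lf i)].
Qed.

Lemma lipschitz_pasting (g : R * R -> R) (C : I -> set (R * R)) (L : R) :
  0 <= L -> (forall i, closed (C i)) -> \bigcup_i C i = setT ->
  (forall i x y, C i x -> C i y -> `|g x - g y| <= L * `|x - y|) ->
  forall x y, `|g x - g y| <= L * `|x - y|.
Proof.
move=> L0 clC CT Lg x y.
pose p (t : R) : R * R := y + t *: (x - y).
have p0 : p 0 = y by rewrite /p scale0r addr0.
have p1 : p 1 = x by rewrite /p scale1r addrC subrK.
have cp : continuous p.
  move=> t; apply: cvgD; first exact: cvg_cst.
  by apply: cvgZr_tmp; exact: cvg_id.
have := @lipschitz_pasting_line (g \o p) (fun i => p @^-1` C i) (L * `|x - y|) 0 1.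
rewrite subr0 mulr1 /= p0 p1; apply => //.
- by move=> i; apply: closed_comp => //.
- by move=> t _; have [i _ Ci] : (\bigcup_i C i) (p t) by [rewrite CT]; exists i.
- move=> i s t _ _ Cs Ct; rewrite (le_trans (Lg _ _ _ Cs Ct))// -mulrA ler_wpM2l//.
  by rewrite /p opprD addrACA subrr add0r -scalerBl normrZ mulrC.
Qed.

End LipschitzPasting.

(** * Integrals of derivatives of Lipschitz functions with bounded support *)

Section DifferenceQuotients.
Context {R : realType}.
Local Notation plane := (measurableTypeR R * measurableTypeR R)%type.
Local Notation area := (@area R).

Lemma bounded_integrable_plane (D : set plane) (f : R * R -> R) (L : R) :
  measurable D -> (area D < +oo)%E -> measurable_fun D f ->
  (forall x, D x -> `|f x| <= L) -> area.-integrable D (EFin \o f).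
Proof.
move=> mD Doo mf fL; apply: measurable_bounded_integrable => //.
exists L; split; first exact: num_real.
by move=> M LM x Dx; apply: le_trans (ltW LM); exact: fL.
Qed.

Lemma bounded_set_ball (M : R) : bounded_set [set x : R * R | `|x| <= M].
Proof.
exists M; split; first exact: num_real.
by move=> K MK x /= xM; rewrite (le_trans xM)// ltW.
Qed.

Lemma closed_norm_le (M : R) : closed [set x : R * R | `|x| <= M].
Proof.
by apply: closed_comp (@closed_le _ M) => x _; exact: norm_continuous.
Qed.

Lemma bounded_support_integrable (f : R * R -> R) (L M : R) :
  measurable_fun [set: plane] f -> (forall x, `|f x| <= L) ->
  (forall x, M < `|x| -> f x = 0) -> area.-integrable [set: plane] (EFin \o f).
Proof.
move=> mf fL fM.
pose B : set plane := [set x : R * R | `|x| <= M].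
have mB : measurable B by apply: closed_measurable_plane; exact: closed_norm_le.
have Boo : (area B < +oo)%E.
  by apply: area_bounded_lt_pinfty => //; exact: bounded_set_ball.
suff -> : (EFin \o f) = ((EFin \o f) \_ B)%E.
  apply: (integrable_mkcond _ mB).1.
  by apply: (@bounded_integrable_plane _ f L) => //; exact: measurable_funTS.
apply/funext => x; rewrite patchE; case: ifPn => //.
by rewrite notin_setE /B/= => /negP; rewrite -ltNge => /fM ->.
Qed.

(** Dominated convergence off the null set [N], the dominating function being
    [L] on the ball of radius [M]. *)
Lemma integral_limit_eq0 (F_ : nat -> R * R -> R) (F : R * R -> R)
    (N : set plane) (L M : R) :
  measurable N -> area N = 0%E ->
  (forall n, measurable_fun [set: plane] (F_ n)) ->
  (forall n x, `|F_ n x| <= L) -> (forall n x, M < `|x| -> F_ n x = 0) ->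
  (forall n, \int[area]_x F_ n x = 0) ->
  (forall x, ~ N x -> F_ n x @[n --> \oo] --> F x) ->
  area.-integrable (~` N) (EFin \o F) /\ \int[area]_(x in ~` N) F x = 0.
Proof.
move=> mN N0 mF FL FM F0 FF.
have mCN : measurable (~` N) by exact: measurableC.
pose G (x : R * R) := L * \1_[set x : R * R | `|x| <= M] x.
have mB : measurable ([set x : R * R | `|x| <= M] : set plane).
  by apply: closed_measurable_plane; exact: closed_norm_le.
have iG : area.-integrable (~` N) (EFin \o G).
  apply: (@integrableS _ _ _ _ setT) => //.
  apply: (@bounded_support_integrable _ `|L| M).
  - by apply: measurable_funM; [exact: measurable_cst|exact: measurable_indic].
  - move=> x; rewrite /G indicE normrM; case: (_ \in _); rewrite ?normr1 ?mulr1//.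
    by rewrite normr0 mulr0.
  - move=> x Mx; rewrite /G indicE memNset ?mulr0//= => xM.
    by rewrite ltNge xM in Mx.
have mFn n : measurable_fun (~` N) (EFin \o F_ n).
  by apply/measurable_EFinP; exact: measurable_funTS.
have FFE x : (~` N) x -> (EFin \o F_ n) x @[n --> \oo] --> (EFin \o F) x.
  by move=> Nx; apply: cvg_EFin; [exact: nearW|exact: FF].
have Fdom n x : (~` N) x -> (`|(EFin \o F_ n) x| <= (EFin \o G) x)%E.
  move=> _; rewrite /= lee_fin /G indicE.
  have [xM|] := leP `|x| M; first by rewrite mem_set// mulr1.
  by move=> /[dup] Mx /FM ->; rewrite normr0 memNset ?mulr0//= leNgt Mx.
have iFn n : area.-integrable (~` N) (EFin \o F_ n).
  apply: le_integrable iG => // x Nx.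
  by apply: le_trans (Fdom n x Nx) _; exact: lee_abs.
have [|||iF _ lF] := @dominated_convergence _ _ _ area _ mCN (fun n => EFin \o F_ n)
  (EFin \o F) _ mFn _ _ iG.
- exact: emeasurable_fun_cvg mFn FFE.
- by apply: aeW => x; exact: FFE.
- by apply: aeW => x n; exact: Fdom.
split=> //.
rewrite /Rintegral.
suff -> : (\int[area]_(x in ~` N) (F x)%:E = 0)%E by [].
move/cvg_lim : lF => <-//; apply: lim_near_cst => //; apply: nearW => n.
have := F0 n; rewrite /Rintegral (integral_setD_null _ _ mN N0) setTD => F0n.
by rewrite -[LHS]fineK; [congr EFin; exact: F0n|exact: integrable_fin_num].
Qed.

(** Bundled so that it can be transferred from a function to its absolute value. *)
Definition lipschitz_bounded_support (g : R * R -> R) (L K M : R) : Prop :=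
  [/\ 0 <= L, forall x y, `|g x - g y| <= L * `|x - y|,
      forall x, `|g x| <= K & forall x, M < `|x| -> g x = 0].

Lemma lipschitz_bounded_support_norm (g : R * R -> R) (L K M : R) :
  lipschitz_bounded_support g L K M ->
  lipschitz_bounded_support (fun x => `|g x|) L K M.
Proof.
move=> [L0 gL gK gM]; split=> // [x y|x|x /gM ->]; last by rewrite normr0.
  by rewrite (le_trans (ler_dist_dist _ _)).
by rewrite normr_id.
Qed.

Lemma lipschitz_continuous (g : R * R -> R) (L : R) :
  0 <= L -> (forall x y, `|g x - g y| <= L * `|x - y|) -> continuous g.
Proof.
move=> L0 gL x; apply/cvgrPdist_lt => e e0; near=> y.
rewrite (le_lt_trans (gL x y))// (@le_lt_trans _ _ ((L + 1) * `|x - y|))//.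
  by rewrite ler_wpM2r// lerDl.
rewrite mulrC -ltr_pdivlMr ?ltr_wpDl//; near: y.
apply: (@cvgr_dist_lt _ _ _ (nbhs x) _ id x); first exact: cvg_id.
by rewrite divr_gt0// ltr_wpDl.
Unshelve. all: by end_near. Qed.

Lemma lipschitz_bounded_support_integrable (g : R * R -> R) (L K M : R) (w : R * R) :
  lipschitz_bounded_support g L K M ->
  measurable_fun [set: plane] (fun x => g (x + w)) /\
  area.-integrable [set: plane] (fun x => (g (x + w))%:E).
Proof.
move=> [L0 gL gK gM].
have gLw x y : `|g (x + w) - g (y + w)| <= L * `|x - y|.
  by rewrite (le_trans (gL _ _))// opprD addrACA subrr addr0.
have mg : measurable_fun [set: plane] (fun x => g (x + w)).
  apply: open_continuous_measurable_plane; first exact: openT.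
  by move=> x _; exact: (lipschitz_continuous L0 gLw).
split=> //; apply: (@bounded_support_integrable _ K (M + `|w|) mg) => // x.
move=> Mx; apply: gM; rewrite -(ltrD2r `|w|) (lt_le_trans Mx)//.
by rewrite -{1}(addrK w x) (le_trans (ler_normB _ _)).
Qed.

Lemma integral_difference_eq0 (g : R * R -> R) (L K M : R) (w : R * R) :
  lipschitz_bounded_support g L K M ->
  \int[area]_x (g (x + w) - g x) = 0.
Proof.
move=> gLKM.
have [mg ig] := lipschitz_bounded_support_integrable w gLKM.
have [] := lipschitz_bounded_support_integrable 0 gLKM.
under eq_fun do rewrite addr0; under [X in _ -> integrable _ _ X -> _]eq_fun do rewrite addr0.
move=> mg0 ig0.
by rewrite RintegralB// Rintegral_shift// subrr.
Qed.

Lemma difference_quotient_cvg (g : R * R -> R) (x v : R * R) (u : nat -> R) :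
  derivable g x v -> u n @[n --> \oo] --> 0 -> (forall n, u n != 0) ->
  (u n)^-1 * (g (x + u n *: v) - g x) @[n --> \oo] --> 'D_v g x.
Proof.
move=> dg u0 un0.
have u0' : u n @[n --> \oo] --> 0^'.
  move=> A /u0 uA; have : \forall n \near \oo, u n != 0 -> A (u n) by exact: uA.
  by apply: filterS => n; exact.
have := cvg_comp _ _ u0' dg; apply: cvg_trans; apply: near_eq_cvg.
by apply: nearW => n /=; rewrite [u n *: v + x]addrC.
Qed.

Let h (n : nat) : R := n.+1%:R^-1.

Let h_gt0 n : 0 < h n. Proof. by rewrite /h invr_gt0. Qed.

Let hv_le n (v : R * R) : `|h n *: v| <= `|v|.
Proof.
rewrite normrZ gtr0_norm//; apply: ler_piMl => //.
by rewrite invf_le1// ler1n.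
Qed.

Let h_cvg : h n @[n --> \oo] --> 0.
Proof. exact: cvg_harmonic. Qed.

(** Difference quotients have mean zero, since the area is invariant under
    translations, and they are dominated. *)
Lemma integral_derive_eq0 (g : R * R -> R) (L K M : R) (v : R * R) (N : set plane) :
  lipschitz_bounded_support g L K M -> measurable N -> area N = 0%E ->
  (forall x, ~ N x -> derivable g x v) ->
  area.-integrable (~` N) (fun x => ('D_v g x)%:E) /\
  \int[area]_(x in ~` N) 'D_v g x = 0.
Proof.
move=> gLKM mN N0 dg; have [L0 gL gK gM] := gLKM.
pose q n x := (h n)^-1 * (g (x + h n *: v) - g x).
have [mgw igw] : (forall w, measurable_fun [set: plane] (fun x => g (x + w))) /\
    (forall w, area.-integrable [set: plane] (fun x => (g (x + w))%:E)).
  by split=> w; have [] := lipschitz_bounded_support_integrable w gLKM.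
have mg : measurable_fun [set: plane] g.
  by have := mgw 0; under eq_fun do rewrite addr0.
have ig : area.-integrable [set: plane] (EFin \o g).
  by have := igw 0; under [X in integrable _ _ X -> _]eq_fun do rewrite addr0.
apply: (@integral_limit_eq0 q _ N (L * `|v|) (M + `|v|)) => //.
- move=> n; apply: measurable_funM; first exact: measurable_cst.
  exact: measurable_funB.
- move=> n x; rewrite /q normrM gtr0_norm ?invr_gt0//.
  rewrite mulrC ler_pdivrMr// (le_trans (gL _ _))//.
  by rewrite addrC addKr normrZ (gtr0_norm (h_gt0 n)) mulrA mulrAC.
- move=> n x Mx; rewrite /q !gM ?subrr ?mulr0//.
    by rewrite (le_lt_trans _ Mx)// lerDl.
  rewrite -(ltrD2r `|v|) (lt_le_trans Mx)//.
  rewrite -{1}(addrK (h n *: v) x) (le_trans (ler_normB _ _))// lerD2l.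
  exact: hv_le.
- move=> n; rewrite /q RintegralZl//; last first.
    exact: (integrableB measurableT (igw _) ig).
  by rewrite (integral_difference_eq0 _ gLKM) mulr0.
- move=> x Nx; apply: difference_quotient_cvg => //; first exact: dg.
  by move=> n; rewrite gt_eqF.
Qed.

(** The second difference quotients of [`|g|] have mean zero and tend to
    [2 * `|'D_v g|] where [g] vanishes, and to zero where it does not. *)
Lemma integral_derive_zeros (g : R * R -> R) (L K M : R) (v : R * R) (N : set plane) :
  lipschitz_bounded_support g L K M -> measurable N -> area N = 0%E ->
  (forall x, ~ N x -> derivable g x v) ->
  let G x := if g x == 0 then 2 * `|'D_v g x| else 0 in
  area.-integrable (~` N) (EFin \o G) /\ \int[area]_(x in ~` N) G x = 0.
Proof.
move=> /[dup] gLKM0 /lipschitz_bounded_support_norm gLKM mN N0 dg G.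
have [L0 gL gK gM] := gLKM.
pose f x := `|g x|.
pose q n x := (h n)^-1 * ((f (x + h n *: v) - f x) + (f (x - h n *: v) - f x)).
have [mgw igw] : (forall w, measurable_fun [set: plane] (fun x => f (x + w))) /\
    (forall w, area.-integrable [set: plane] (fun x => (f (x + w))%:E)).
  by split=> w; have [] := lipschitz_bounded_support_integrable w gLKM.
have mg : measurable_fun [set: plane] f.
  by have := mgw 0; under eq_fun do rewrite addr0.
have ig : area.-integrable [set: plane] (EFin \o f).
  by have := igw 0; under [X in integrable _ _ X -> _]eq_fun do rewrite addr0.
have fM n x : M + `|v| < `|x| -> [/\ f x = 0, f (x + h n *: v) = 0 & f (x - h n *: v) = 0].
  move=> Mx; split; apply: gM.
  - by rewrite (le_lt_trans _ Mx)// lerDl.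
  - rewrite -(ltrD2r `|v|) (lt_le_trans Mx)//.
    rewrite -{1}(addrK (h n *: v) x) (le_trans (ler_normB _ _))// lerD2l.
    exact: hv_le.
  - rewrite -(ltrD2r `|v|) (lt_le_trans Mx)//.
    rewrite -{1}(subrK (h n *: v) x) (le_trans (ler_normD _ _))// lerD2l.
    exact: hv_le.
apply: (@integral_limit_eq0 q _ N (2 * (L * `|v|)) (M + `|v|)) => //.
- move=> n; apply: measurable_funM; first exact: measurable_cst.
  by apply: measurable_funD; apply: measurable_funB.
- move=> n x; rewrite /q normrM gtr0_norm ?invr_gt0//.
  rewrite mulrC ler_pdivrMr// (le_trans (ler_normD _ _))// mulrDl mul1r mulrDl.
  have b w : `|w| = h n * `|v| -> `|f (x + w) - f x| <= L * `|v| * h n.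
    by move=> wE; rewrite (le_trans (gL _ _))// addrC addKr wE mulrA mulrAC.
  by apply: lerD; apply: b; rewrite ?normrN normrZ (gtr0_norm (h_gt0 n)).
- by move=> n x /(fM n)[fx fxp fxm]; rewrite /q fx fxp fxm subrr addr0 mulr0.
- move=> n; rewrite /q.
  have iB w : area.-integrable [set: plane] (EFin \o (fun x => f (x + w) - f x)).
    exact: (integrableB measurableT (igw _) ig).
  rewrite RintegralZl//; last exact: (integrableD measurableT (iB _) (iB _)).
  by rewrite RintegralD//; [rewrite !(integral_difference_eq0 _ gLKM) addr0 mulr0|exact: iB..].
- move=> x Nx; rewrite /G.
  have qp := difference_quotient_cvg (dg _ Nx) h_cvg (fun n => lt0r_neq0 (h_gt0 n)).
  have qm : (- h n)^-1 * (g (x + (- h n) *: v) - g x) @[n --> \oo] --> 'D_v g x.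
    apply: difference_quotient_cvg; [exact: dg| |].
      by rewrite -[X in _ --> X]oppr0; apply: cvgN; exact: h_cvg.
    by move=> n; rewrite oppr_eq0 gt_eqF.
  case: eqP => [gx0|/eqP gx0].
    rewrite mulr_natl mulr2n.
    rewrite (_ : (fun n => q n x) = fun n => `|(h n)^-1 * (g (x + h n *: v) - g x)| +
        `|(- h n)^-1 * (g (x + (- h n) *: v) - g x)|).
      by apply: cvgD; apply: cvg_norm.
    apply/funext => n; rewrite /q /f gx0 normr0 !subr0 !normrM scaleNr mulrDr.
    have hV0 : 0 < (h n)^-1 by rewrite invr_gt0.
    by rewrite invrN normrN (gtr0_norm hV0).
  (* Near [x] the sign of [g] is constant, so the second difference quotient is
     a difference of two difference quotients with the same limit. *)
  have cg : {for x, continuous g}.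
    by have [? gL0 _ _] := gLKM0; exact: (lipschitz_continuous _ gL0).
  pose s := Num.sg (g x).
  have sg : \forall y \near x, f y = s * g y.
    have [g0|g0] : 0 < g x \/ g x < 0 by apply/orP; rewrite -neq_lt eq_sym.
      rewrite /s gtr0_sg//; near=> y; rewrite mul1r /f gtr0_norm//; near: y.
      exact: (cvgr_gt _ cg).
    rewrite /s ltr0_sg//; near=> y; rewrite mulN1r /f ltr0_norm//; near: y.
    exact: (cvgr_lt _ cg).
  have near_x (u : nat -> R) : u n @[n --> \oo] --> 0 ->
      \forall n \near \oo, f (x + u n *: v) = s * g (x + u n *: v).
    move=> u0; have : x + u n *: v @[n --> \oo] --> x.
      rewrite -[X in _ --> X]addr0 -[X in _ + X](scale0r v).
      by apply: cvgD; [exact: cvg_cst|exact: cvgZr_tmp].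
    by move/(_ _ sg).
  have : s * ((h n)^-1 * (g (x + h n *: v) - g x)
      - (- h n)^-1 * (g (x + (- h n) *: v) - g x)) @[n --> \oo] --> 0.
    rewrite -[X in _ --> X](mulr0 s) -[X in _ * X](subrr ('D_v g x)).
    by apply: cvgM; [exact: cvg_cst|exact: cvgB].
  apply: cvg_trans; apply: near_eq_cvg.
  have hN : - h n @[n --> \oo] --> 0.
    by rewrite -[X in _ --> X]oppr0; apply: cvgN; exact: h_cvg.
  near=> n; rewrite /q.
  rewrite (_ : f (x + h n *: v) = s * g (x + h n *: v)); last first.
    by near: n; exact: near_x.
  rewrite (_ : f (x - h n *: v) = s * g (x + - h n *: v)); last first.
    by rewrite -scaleNr; near: n; exact: near_x.
  rewrite (_ : f x = s * g x); last by rewrite /f /s normrEsg.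
  by rewrite invrN mulNr opprK -!mulrBr -!mulrDr mulrCA.
Unshelve. all: by end_near. Qed.

(** Outside [O] the derivative is dominated by the function of
    [integral_derive_zeros], so its integral over [O] is that over the plane. *)
Lemma integral_derive_vanishing_outside (g : R * R -> R) (L K M : R) (v : R * R)
    (N O : set plane) :
  lipschitz_bounded_support g L K M -> measurable N -> area N = 0%E ->
  (forall x, ~ N x -> derivable g x v) ->
  measurable O -> (forall x, ~ O x -> g x = 0) ->
  \int[area]_(x in O `\` N) 'D_v g x = 0.
Proof.
move=> gLKM mN N0 dg mO gO.
have [iD D0] := integral_derive_eq0 gLKM mN N0 dg.
have [iG G0] := integral_derive_zeros gLKM mN N0 dg.
set G := (fun x => if _ then _ else _) in iG G0.
have mCN : measurable (~` N) by exact: measurableC.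
have mON : measurable (O `\` N) by exact: measurableD.
have mCON : measurable (~` N `\` O) by exact: measurableD.
have iDO : area.-integrable (O `\` N) (fun x => ('D_v g x)%:E).
  by apply: integrableS iD => // x [].
have iDC : area.-integrable (~` N `\` O) (fun x => ('D_v g x)%:E).
  by apply: integrableS iD => // x [].
have iGC : area.-integrable (~` N `\` O) (EFin \o G).
  by apply: integrableS iG => // x [].
have E : ~` N = (O `\` N) `|` (~` N `\` O).
  apply/seteqP; split=> x /=; last by case=> -[].
  by move=> Nx; have [Ox|Ox] := pselect (O x); [left|right].
have D1 : [disjoint O `\` N & ~` N `\` O].
  by apply/disj_setPS => x [[Ox _] [_ /(_ Ox)]].
have split_int F : area.-integrable (~` N) (EFin \o F) ->
    \int[area]_(x in ~` N) F x =
    \int[area]_(x in O `\` N) F x + \int[area]_(x in ~` N `\` O) F x.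
  move=> iF; rewrite {1}E Rintegral_setU//.
  by move: iF; rewrite [in X in X -> _]E.
have G_ge0 x : 0 <= G x by rewrite /G; case: ifP => // _; rewrite mulr_ge0.
have GC : \int[area]_(x in ~` N `\` O) G x <= 0.
  by rewrite -G0 (split_int _ iG) lerDr; apply: Rintegral_ge0 => x _; exact: G_ge0.
have DC : \int[area]_(x in ~` N `\` O) 'D_v g x = 0.
  apply/eqP; rewrite -normr_le0 (le_trans _ GC)//.
  rewrite (le_trans (le_normr_Rintegral _ iDC))// le_Rintegral//.
    exact: (integrable_abse iDC).
  move=> x [_ Ox]; rewrite /G gO// eqxx ler_peMl// ler1n//.
by move: D0; rewrite (split_int _ iD) DC addr0.
Qed.

End DifferenceQuotients.

(** * Polynomials as smooth functions *)

Section SmoothFunctions.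
Context {R : realType}.
Implicit Types (p q : R * R -> R).

(** The properties of polynomials used below, in a form that is stable under
    sums and products. *)
Definition smooth p : Prop :=
  [/\ forall j x, derivable p x (e_ j), forall j, continuous (partial j p),
      continuous p &
      forall M, exists2 L, 0 <= L & forall x y, `|x| <= M -> `|y| <= M ->
        `|p x - p y| <= L * `|x - y|].

Lemma eq_smooth p q : p =1 q -> smooth p -> smooth q.
Proof. by move=> /funext ->. Qed.

Lemma smooth_cst c : smooth (fun=> c).
Proof.
split=> [j x|j|x|M].
- exact: derivable_cst.
- rewrite (_ : partial j _ = fun=> 0); first by move=> x; exact: cvg_cst.
  by apply/funext => x; rewrite /partial derive_cst.
- exact: cvg_cst.
- by exists 0 => // x y _ _; rewrite subrr normr0 mul0r.
Qed.

Lemma linear_is_derive p j x : (forall a x y, p (a *: x + y) = a * p x + p y) ->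
  is_derive x (e_ j) p (p (e_ j)).
Proof.
move=> lp.
have q_cst h : h != 0 -> h^-1 *: ((p \o shift x) (h *: e_ j) - p x) = p (e_ j).
  move=> h0; rewrite (_ : (p \o shift x) _ = p (h *: e_ j + x))// lp addrK.
  by rewrite scalerA mulVf// scale1r.
have q_near : \forall h \near 0^', h^-1 *: ((p \o shift x) (h *: e_ j) - p x) = p (e_ j).
  by near=> h; apply: q_cst; near: h; exact: nbhs_dnbhs_neq.
apply: DeriveDef; last exact: lim_near_cst.
by apply/cvg_ex; exists (p (e_ j)); exact: cvg_near_cst.
Unshelve. all: by end_near. Qed.

Lemma smooth_linear p : (forall a x y, p (a *: x + y) = a * p x + p y) ->
  (forall x, `|p x| <= `|x|) -> smooth p.
Proof.
move=> lp np.
have p0 : p 0 = 0.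
  by have := lp 1 0 0; rewrite scaler0 addr0 mul1r => /eqP; rewrite addrC -subr_eq subrr => /eqP <-.
have pB x y : p x - p y = p (x - y).
  by rewrite -(scaleN1r y) addrC [x + _]addrC lp mulN1r.
have der j x := linear_is_derive j x lp.
have lipp x y : `|p x - p y| <= 1 * `|x - y| by rewrite pB mul1r.
split=> [j x|j||M].
- by case: (der j x).
- rewrite (_ : partial j p = fun=> p (e_ j)); first by move=> x; exact: cvg_cst.
  by apply/funext => x; rewrite /partial; case: (der j x).
- exact: lipschitz_continuous lipp.
- by exists 1.
Qed.

Lemma smooth_fst : smooth fst.
Proof. by apply: smooth_linear => // x; rewrite prod_normE le_max lexx. Qed.

Lemma smooth_snd : smooth snd.
Proof. by apply: smooth_linear => // x; rewrite prod_normE le_max lexx orbT. Qed.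

Lemma smoothD p q : smooth p -> smooth q -> smooth (fun x => p x + q x).
Proof.
move=> [dp cdp cp lp] [dq cdq cq lq]; split=> [j x|j|x|M].
- exact: derivableD.
- rewrite (_ : partial j _ = fun x => partial j p x + partial j q x).
    by move=> x; apply: cvgD; [exact: cdp|exact: cdq].
  by apply/funext => x; rewrite /partial -deriveD.
- by apply: cvgD; [exact: cp|exact: cq].
- have [L1 L10 pL] := lp M; have [L2 L20 qL] := lq M.
  exists (L1 + L2); first exact: addr_ge0.
  move=> x y xM yM; rewrite opprD addrACA (le_trans (ler_normD _ _))//.
  by rewrite mulrDl lerD// ?pL ?qL.
Qed.

Lemma smoothM p q : smooth p -> smooth q -> smooth (fun x => p x * q x).
Proof.
move=> [dp cdp cp lp] [dq cdq cq lq]; split=> [j x|j|x|M].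
- exact: derivableM.
- rewrite (_ : partial j _ = fun x => p x * partial j q x + q x * partial j p x).
    by move=> x; apply: cvgD; apply: cvgM; [exact: cp|exact: cdq|exact: cq|exact: cdp].
  by apply/funext => x; rewrite /partial -deriveM.
- by apply: cvgM; [exact: cp|exact: cq].
- have [L1 L10 pL] := lp M; have [L2 L20 qL] := lq M.
  have bnd (f : R * R -> R) L x : 0 <= L -> `|x| <= M ->
      (forall x y, `|x| <= M -> `|y| <= M -> `|f x - f y| <= L * `|x - y|) ->
      `|f x| <= `|f 0| + L * M.
    move=> L0 xM fL; rewrite -[f x](subrK (f 0)) addrC (le_trans (ler_normD _ _))//.
    rewrite lerD2l (le_trans (fL _ _ xM _))//.
      by rewrite normr0 (le_trans _ xM).
    by rewrite subr0 ler_wpM2l.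
  exists (Num.max 0 (L1 * (`|q 0| + L2 * M) + L2 * (`|p 0| + L1 * M))).
    by rewrite le_max lexx.
  move=> x y xM yM; rewrite -(subrKA (p y * q x)) -mulrBl -mulrBr.
  rewrite (le_trans (ler_normD _ _))// !normrM.
  apply: (@le_trans _ _ ((L1 * (`|q 0| + L2 * M) + L2 * (`|p 0| + L1 * M)) * `|x - y|)).
    rewrite mulrDl lerD//.
      by rewrite mulrAC ler_pM// ?pL ?bnd.
    by rewrite mulrAC mulrC ler_pM// ?qL ?bnd.
  by apply: ler_wpM2r => //; rewrite le_max lexx orbT.
Qed.

Lemma smooth_sum (I : Type) (s : seq I) (P : pred I) (p : I -> R * R -> R) :
  (forall i, smooth (p i)) -> smooth (fun x => \sum_(i <- s | P i) p i x).
Proof.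
move=> sp; elim: s => [|i s IHs].
  by apply: eq_smooth (smooth_cst 0) => x; rewrite big_nil.
case Pi: (P i).
  by apply: eq_smooth (smoothD (sp i) IHs) => x; rewrite big_cons Pi.
by apply: eq_smooth IHs => x; rewrite big_cons Pi.
Qed.

Lemma smoothX p n : smooth p -> smooth (fun x => p x ^+ n).
Proof.
move=> sp; elim: n => [|n IHn].
  by apply: eq_smooth (smooth_cst 1) => x; rewrite expr0.
by apply: eq_smooth (smoothM sp IHn) => x; rewrite exprS.
Qed.

Lemma poly_on_smooth r K f : poly_on r K f ->
  exists p : R * R -> R, smooth p /\ forall x, K x -> f x = p x.
Proof.
move=> [c fc]; exists (fun x => \sum_(i < r.+1) \sum_(j < r.+1 | (i + j <= r)%N)
  c i j * x.1 ^+ i * x.2 ^+ j); split=> //.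
apply: smooth_sum => i; apply: smooth_sum => j.
apply: smoothM; last exact: smoothX smooth_snd.
by apply: smoothM; [exact: smooth_cst|exact: smoothX smooth_fst].
Qed.

Lemma continuous_bounded_ball p M : continuous p ->
  exists L, forall x, `|x| <= M -> `|p x| <= L.
Proof.
move=> cp.
have cB : compact ([set` `[- M, M]] `*` [set` `[- M, M]] : set (R * R)).
  by apply: compact_setX; exact: segment_compact.
have : compact (p @` ([set` `[- M, M]] `*` [set` `[- M, M]])).
  by apply: continuous_compact => //; exact: continuous_subspaceT.
move=> /compact_bounded[L [_ /(_ (L + 1))]]; rewrite ltrDl ltr01 => /(_ isT) bL.
exists (L + 1) => x xM; apply: (bL (p x)); exists x => //.
move: xM; rewrite prod_normE ge_max !ler_norml => /andP[xM1 xM2].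
by rewrite /= !in_itv.
Qed.

End SmoothFunctions.

(** * Bounded continuous functions on an open set *)

Section BoundedContinuous.
Context {R : realType}.
Local Notation plane := (measurableTypeR R * measurableTypeR R)%type.
Local Notation area := (@area R).
Implicit Types (D : set (R * R)) (f g : R * R -> R).

(** Off the skeleton of a triangulation, all the integrands of the scheme are of
    this kind, up to a factor that is an observation. *)
Definition bounded_continuous D f : Prop :=
  (forall x, D x -> {for x, continuous f}) /\
  exists L, forall x, D x -> `|f x| <= L.

Lemma bounded_continuous_cst D c : bounded_continuous D (fun=> c).
Proof. by split=> [x _|]; [exact: cvg_cst|exists `|c|]. Qed.

Lemma bounded_continuousD D f g : bounded_continuous D f ->
  bounded_continuous D g -> bounded_continuous D (fun x => f x + g x).
Proof.
move=> [cf [L fL]] [cg [K gK]]; split=> [x Dx|].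
  by apply: cvgD; [exact: cf|exact: cg].
exists (L + K) => x Dx; rewrite (le_trans (ler_normD _ _))//.
by rewrite lerD// ?fL ?gK.
Qed.

Lemma bounded_continuousM D f g : bounded_continuous D f ->
  bounded_continuous D g -> bounded_continuous D (fun x => f x * g x).
Proof.
move=> [cf [L fL]] [cg [K gK]]; split=> [x Dx|].
  by apply: cvgM; [exact: cf|exact: cg].
by exists (L * K) => x Dx; rewrite normrM ler_pM// ?fL ?gK.
Qed.

Lemma bounded_continuousN D f : bounded_continuous D f ->
  bounded_continuous D (fun x => - f x).
Proof.
move=> [cf [L fL]]; split=> [x Dx|]; first by apply: cvgN; exact: cf.
by exists L => x Dx; rewrite normrN fL.
Qed.

Lemma bounded_continuous_sum D (I : Type) (s : seq I) (P : pred I)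
    (f : I -> R * R -> R) : (forall i, bounded_continuous D (f i)) ->
  bounded_continuous D (fun x => \sum_(i <- s | P i) f i x).
Proof.
move=> bf; elim: s => [|i s IHs].
  by under eq_fun do rewrite big_nil; exact: bounded_continuous_cst.
under eq_fun do rewrite big_cons.
by case: (P i) => //; exact: bounded_continuousD.
Qed.

Lemma bounded_continuousV D f c : 0 < c -> (forall x, D x -> c <= f x) ->
  bounded_continuous D f -> bounded_continuous D (fun x => (f x)^-1).
Proof.
move=> c0 cf [ctf _]; split=> [x Dx|].
  by apply: cvgV; [rewrite gt_eqF// (lt_le_trans c0)// cf|exact: ctf].
exists c^-1 => x Dx; have fx0 : 0 < f x by rewrite (lt_le_trans c0)// cf.
by rewrite gtr0_norm ?invr_gt0// lef_pV2 ?posrE// cf.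
Qed.

Lemma bounded_continuous_comp D f (g : R -> R) a b :
  (forall x, D x -> a <= f x <= b) -> continuous g ->
  bounded_continuous D f -> bounded_continuous D (g \o f).
Proof.
move=> abf cg [cf _]; split=> [x Dx|].
  by apply: continuous_comp; [exact: cf|exact: cg].
have : compact (g @` `[a, b]%classic).
  by apply: continuous_compact; [exact: continuous_subspaceT|exact: segment_compact].
move=> /compact_bounded[L [_ /(_ (L + 1))]]; rewrite ltrDl ltr01 => /(_ isT) bL.
exists (L + 1) => x Dx; apply: (bL (g (f x))); exists (f x) => //.
by rewrite /= in_itv/= abf.
Qed.

Context (D : set (R * R)) (oD : open D) (bD : bounded_set D).

Lemma measurable_open_bounded : measurable (D : set plane) /\ (area D < +oo)%E.
Proof.
have mD : measurable (D : set plane) by exact: open_measurable_plane.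
by split=> //; exact: area_bounded_lt_pinfty.
Qed.

Lemma bounded_continuous_integrable f : bounded_continuous D f ->
  area.-integrable D (EFin \o f).
Proof.
move=> [cf [L fL]]; have [mD Doo] := measurable_open_bounded.
apply: (bounded_integrable_plane mD Doo _ fL).
exact: open_continuous_measurable_plane.
Qed.

Lemma bounded_continuousM_integrable f g :
  area.-integrable D (EFin \o f) -> bounded_continuous D g ->
  area.-integrable D (EFin \o (fun x => f x * g x)).
Proof.
move=> lf [cg [L gL]]; have [mD _] := measurable_open_bounded.
have mg : measurable_fun (D : set plane) g by exact: open_continuous_measurable_plane.
apply: (le_integrable mD _ _ (integrableZl mD `|L| lf)).
  apply/measurable_EFinP/measurable_funM => //.
  by apply/measurable_EFinP; exact: measurable_int lf.
move=> x Dx /=; rewrite lee_fin !normrM normr_id mulrC.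
by rewrite ler_wpM2r// (le_trans (gL _ Dx))// ler_norm.
Qed.

(** The points where [f] does not vanish form an open null set, which is empty. *)
Lemma Rintegral_eq0_bounded_continuous f : bounded_continuous D f ->
  (forall x, D x -> 0 <= f x) -> \int[area]_(x in D) f x = 0 ->
  forall x, D x -> f x = 0.
Proof.
move=> bcf f0 If x Dx; have [mD _] := measurable_open_bounded.
have iF := bounded_continuous_integrable bcf.
have [cf _] := bcf.
have : (\int[area]_(x in D) `|(EFin \o f) x| = 0)%E.
  transitivity (\int[area]_(x in D) (f x)%:E)%E.
    by apply: eq_integral => y; rewrite inE => Dy; rewrite /= ger0_norm// f0.
  rewrite -[LHS]fineK; last exact: integrable_fin_num.
  by congr EFin.
move/ae_eq_integral_abs => /(_ mD (measurable_int _ iF)) [N [mN N0 DN]].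
apply: contrapT => /eqP fx0.
pose U : set (R * R) := D `&` [set y | f y != 0].
have oU : open U.
  rewrite openE => y [Dy fy0]; rewrite /interior; apply: filterI.
    by move: oD; rewrite openE; exact.
  have : \forall z \near f y, z != 0.
    by apply: open_nbhs_nbhs; split=> //; exact: open_neq.
  by move/(cf _ Dy).
have := @area_open_gt0 R U oU (ex_intro _ x (conj Dx fx0)).
suff -> : area U = 0%E by rewrite ltxx.
apply: (@subset_measure0 _ _ _ _ _ N) => //; first exact: open_measurable_plane.
apply: subset_trans DN => y [Dy fy0] /= /(_ Dy) [] /eqP.
by rewrite (negPf fy0).
Qed.

End BoundedContinuous.

(** * Triangulations and their skeleton *)

Section Triangulation.
Context {R : realType} (omega : set (R * R)) (N : nat) (T : 'I_N -> R * R -> R * R).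
Local Notation plane := (measurableTypeR R * measurableTypeR R)%type.
Local Notation area := (@area R).

Definition skeleton : set (R * R) := \bigcup_i frontier (cell (T i)).

Definition off_skeleton : set (R * R) := omega `\` skeleton.

Definition triangulated_domain : Prop :=
  [/\ open omega, bounded_set omega, omega !=set0, connected omega &
      conforming_triangulation omega T].

Context (msh : triangulated_domain).

Let oomega : open omega. Proof. by case: msh. Qed.
Let bomega : bounded_set omega. Proof. by case: msh. Qed.
Let tri : conforming_triangulation omega T. Proof. by case: msh. Qed.

Lemma closed_cell i : closed (cell (T i)).
Proof.
have [/(_ i)[cT _ _ _] _ _] := tri.
apply: compact_closed; first exact: norm_hausdorff.
apply: continuous_compact => //.
have : closed (@ref_triangle R).
  rewrite (_ : ref_triangle = \bigcap_(k in [set: 'I_3]) [set x | 0 <= bary k x]).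
    apply: closed_bigI => k _; apply: closed_comp (@closed_ge _ 0) => x _.
    rewrite /bary; case: (k == 0); last case: (k == 1).
    - apply: cvgB; last exact: cvg_snd.
      by apply: cvgB; [exact: cvg_cst|exact: cvg_fst].
    - exact: cvg_fst.
    - exact: cvg_snd.
  by apply/seteqP; split=> x /= h k; [move=> _|]; exact: h.
pose Q : set (R * R) := [set` `[0, 1]] `*` [set` `[0, 1]].
have cQ : compact Q by apply: compact_setX; exact: segment_compact.
move/(@subclosed_compact _ _ Q); apply => //.
move=> x xr; have := (xr 0, xr 1, xr (@Ordinal 3 2 isT)); rewrite /bary/=.
move=> [[x0 x1] x2]; rewrite /Q/= !in_itv/= x1 x2/=; split; lra.
Qed.

Lemma cell_sub_closure i : cell (T i) `<=` closure omega.
Proof. by have [_ -> _] := tri; move=> x ix; exists i. Qed.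

Lemma closed_frontier (A : set (R * R)) : closed (frontier A).
Proof.
rewrite /frontier setDE; apply: closedI; first exact: closed_closure.
by apply: open_closedC; exact: open_interior.
Qed.

Lemma closed_skeleton : closed skeleton.
Proof.
by apply: closed_bigcup => [|i _]; [exact: finite_finset|exact: closed_frontier].
Qed.

Lemma measurable_skeleton : measurable (skeleton : set plane).
Proof. exact: closed_measurable_plane closed_skeleton. Qed.

Lemma area_skeleton : area skeleton = 0%E.
Proof.
have [mT _ _] := tri; apply: measure_negligible; first exact: measurable_skeleton.
pose F (k : nat) : set plane := if insub k is Some i then frontier (cell (T i)) else set0.
apply: (@negligibleS _ _ _ _ (\bigcup_k F k)).
  by move=> x [i _ ix]; exists (val i) => //; rewrite /F valK.
apply: negligible_bigcup => k; rewrite /F; case: insub => [i|]; last exact: negligible_set0.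
by have [] := mT i.
Qed.

Lemma open_off_skeleton : open off_skeleton.
Proof.
by rewrite /off_skeleton setDE; apply: openI => //; apply: closed_openC; exact: closed_skeleton.
Qed.

Lemma bounded_off_skeleton : bounded_set off_skeleton.
Proof.
have [M [Mr OM]] := bomega; exists M; split=> // K MK x [Ox _].
exact: (OM K MK).
Qed.

Lemma Rintegral_off_skeleton (f : R * R -> R) :
  \int[area]_(x in omega) f x = \int[area]_(x in off_skeleton) f x.
Proof.
rewrite /Rintegral; congr fine.
exact: integral_setD_null measurable_skeleton area_skeleton.
Qed.

(** A nonempty open set is not null, so it is not contained in the skeleton. *)
Lemma off_skeleton_dense : omega `<=` closure off_skeleton.
Proof.
move=> x Ox B xB; apply: contrapT => /nonemptyPn B0.
pose U : set (R * R) := interior B `&` omega.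
have oU : open U by apply: openI => //; exact: open_interior.
have := area_open_gt0 oU (ex_intro _ x (conj xB Ox)).
suff -> : area U = 0%E by rewrite ltxx.
apply: (@subset_measure0 _ _ _ area U (skeleton : set plane)) => //.
- exact: open_measurable_plane.
- exact: measurable_skeleton.
- move=> y [/interior_subset By Oy]; apply: contrapT => sy.
  by have : (off_skeleton `&` B) y by []; rewrite B0.
- exact: area_skeleton.
Qed.

Lemma off_skeleton_interior x : off_skeleton x -> exists i, interior (cell (T i)) x.
Proof.
move=> [Ox nZ]; have [_ cE _] := tri.
have : closure omega x by exact: subset_closure.
rewrite cE => -[i _ ix]; exists i; apply: contrapT => nix.
by apply: nZ; exists i => //; split=> //; exact: subset_closure.
Qed.

Lemma bounded_closure_omega : exists M, forall x, closure omega x -> `|x| <= M.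
Proof.
have [M [_ /(_ (`|M| + 1))]] := bomega.
rewrite (le_lt_trans (ler_norm _) (ltr_pwDr _ _))// => /(_ isT) OM.
exists (`|M| + 1) => x; have cB := @closed_norm_le R (`|M| + 1).
by move=> /(closureS OM); rewrite -(closure_id _).1.
Qed.

Lemma area_off_skeleton : (0 < area off_skeleton < +oo)%E.
Proof.
have [_ _ [x Ox] _ _] := msh; apply/andP; split.
  apply: area_open_gt0; first exact: open_off_skeleton.
  have [y []] : off_skeleton `&` omega !=set0; last by exists y.
  by apply: (off_skeleton_dense Ox); exact: open_nbhs_nbhs.
apply: area_bounded_lt_pinfty; first exact: bounded_off_skeleton.
exact: open_measurable_plane open_off_skeleton.
Qed.

End Triangulation.

(** * Regularity of finite element functions *)

Section FiniteElementFunctions.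
Context {R : realType} (omega : set (R * R)) (N : nat) (T : 'I_N -> R * R -> R * R).
Context (msh : triangulated_domain omega T).
Local Notation Om0 := (off_skeleton omega T).

Let oomega : open omega. Proof. by case: msh. Qed.
Let tri : conforming_triangulation omega T. Proof. by case: msh. Qed.

Section OneFunction.
Context (r : nat) (f : R * R -> R) (fe : fe_space r omega T f).

Lemma fe_smooth : exists p : 'I_N -> R * R -> R,
  forall i, smooth (p i) /\ forall x, cell (T i) x -> f x = p i x.
Proof.
have [_ fT _] := fe.
have /choice[p pP] i := poly_on_smooth (fT i).
by exists p.
Qed.

Lemma fe_near_smooth x : Om0 x -> exists i p,
  [/\ smooth p, forall x, cell (T i) x -> f x = p x & interior (cell (T i)) x].
Proof.
move=> /(off_skeleton_interior msh)[i ix].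
by have [p /(_ i)[sp fp]] := fe_smooth; exists i, (p i).
Qed.

Lemma fe_near_eq i p x : (forall x, cell (T i) x -> f x = p x) ->
  interior (cell (T i)) x -> \forall y \near x, f y = p y.
Proof. by move=> fp; apply: filterS => y; exact: fp. Qed.

Lemma fe_partial i p j x : (forall x, cell (T i) x -> f x = p x) ->
  interior (cell (T i)) x -> partial j f x = partial j p x.
Proof. by move=> fp ix; apply: near_eq_derive; exact: fe_near_eq ix. Qed.

Lemma fe_derivable j x : Om0 x -> derivable f x (e_ j).
Proof.
move=> /fe_near_smooth[i [p [[dp _ _ _] fp ix]]].
apply: near_eq_derivable (dp j x).
by have := fe_near_eq fp ix; apply: filterS => y ->.
Qed.

Lemma fe_bounded : exists L, forall x, closure omega x -> `|f x| <= L.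
Proof.
have [p pP] := fe_smooth; have [M OM] := bounded_closure_omega msh.
have /choice[L LP] i : exists L, forall x, `|x| <= M -> `|p i x| <= L.
  by apply: continuous_bounded_ball; have [[]] := pP i.
exists (\sum_i `|L i|) => x Ox; have [_ cE _] := tri.
have : (\bigcup_i cell (T i)) x by rewrite -cE.
move=> [i _ ix]; rewrite (pP i).2// (le_trans (LP i x (OM _ Ox)))//.
by rewrite (bigD1 i)//= (le_trans (ler_norm _))// lerDl sumr_ge0.
Qed.

Lemma fe_bounded_continuous : bounded_continuous Om0 f.
Proof.
split=> [x [Ox _]|]; last first.
  have [L fL] := fe_bounded; exists L => x [Ox _].
  by apply: fL; exact: subset_closure.
have [cf _ _] := fe.
have : {in omega, continuous f}.
  rewrite -continuous_open_subspace//.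
  by apply: continuous_subspaceW cf; exact: subset_closure.
by apply; rewrite inE.
Qed.

Lemma fe_partial_bounded_continuous j : bounded_continuous Om0 (partial j f).
Proof.
have [p pP] := fe_smooth; have [M OM] := bounded_closure_omega msh.
split=> [x /(off_skeleton_interior msh)[i ix]|].
  have [[_ cp _ _] fp] := pP i.
  have pf : \forall y \near x, partial j (p i) y = partial j f y.
    have : \forall y \near x, interior (cell (T i)) y.
      by apply: open_nbhs_nbhs; split=> //; exact: open_interior.
    by apply: filterS => y iy; rewrite (fe_partial j fp iy).
  rewrite /prop_for /continuous_at (fe_partial j fp ix).
  by apply: cvg_trans (cp j x); exact: near_eq_cvg.
have /choice[L LP] i : exists L, forall x, `|x| <= M -> `|partial j (p i) x| <= L.
  by apply: continuous_bounded_ball; have [[]] := pP i.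
exists (\sum_i `|L i|) => x O0x; have [i ix] := off_skeleton_interior msh O0x.
have [_ fp] := pP i.
rewrite (fe_partial j fp ix) (le_trans (LP i x _))//.
  by apply: OM; apply: subset_closure; case: O0x.
by rewrite (bigD1 i)//= (le_trans (ler_norm _))// lerDl sumr_ge0.
Qed.

(** By continuity up to the closure, in which the complement of the skeleton is
    dense. *)
Lemma fe_eq0 : (forall x, Om0 x -> f x = 0) -> f = fun=> 0.
Proof.
move=> f0; have [cf _ fout] := fe; apply/funext => x.
have [Ox|] := pselect (closure omega x); last exact: fout.
have Ox' : closure Om0 x.
  exact: (@closed_closure _ Om0 _ (closureS (off_skeleton_dense msh) Ox)).
apply: contrapT => /eqP fx0.
have : \forall y \near x, closure omega y -> f y != 0.
  have : \forall z \near f x, z != 0 by apply: open_nbhs_nbhs; split=> //; exact: open_neq.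
  by move/subspace_continuousP : cf => /(_ _ Ox) /[apply].
move=> /Ox'[y [yOm fy0]].
have : f y != 0 by apply: fy0; apply: subset_closure; case: yOm.
by rewrite f0// eqxx.
Qed.

End OneFunction.

End FiniteElementFunctions.

(** * Finite element spaces have finite dimension *)

Section FiniteElementSpaces.
Context {R : realType} (omega : set (R * R)) (N : nat) (T : 'I_N -> R * R -> R * R).

Lemma poly_onD r K (f g : R * R -> R) a : poly_on r K f -> poly_on r K g ->
  poly_on r K (a *: f + g).
Proof.
move=> [c fc] [d gd]; exists (fun i j => a * c i j + d i j) => x Kx.
rewrite -[LHS]/(a * f x + g x) fc// gd// mulr_sumr -big_split; apply: eq_bigr => i _.
rewrite /= mulr_sumr -big_split; apply: eq_bigr => j _.
by rewrite /= !mulrDl !mulrA.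
Qed.

Lemma fe_space_subspace r : subspace_of (fe_space r omega T).
Proof.
split.
  split=> // [x|i]; first exact: cvg_cst.
  exists (fun _ _ => 0) => x _; rewrite big1// => j _; rewrite big1// => k _.
  by rewrite !mul0r.
move=> a f g [cf pf f0] [cg pg g0]; split=> [x|i|x Ox].
- rewrite (_ : a *: f + g = fun x => a * f x + g x)//.
  by apply: cvgD; [apply: cvgM; [exact: cvg_cst|exact: cf]|exact: cg].
- exact: poly_onD.
- by rewrite -[LHS]/(a * f x + g x) f0// g0// mulr0 addr0.
Qed.

Lemma poly_onS r s K (f : R * R -> R) : (r <= s)%N -> poly_on r K f -> poly_on s K f.
Proof.
move=> rs [c fc].
exists (fun i j => if (i + j <= r)%N then c i j else 0) => x Kx; rewrite fc//.
have sub_ord (F : nat -> R) : (forall i, (r < i)%N -> F i = 0) ->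
    \sum_(i < r.+1) F i = \sum_(i < s.+1) F i.
  move=> F0; rewrite -(subnKC rs) -addSn big_split_ord/= [X in _ + X]big1 ?addr0//.
  by move=> i _; rewrite F0//= leq_addr.
under eq_bigr do rewrite big_mkcond/=.
under [RHS]eq_bigr do rewrite big_mkcond/=.
rewrite (sub_ord (fun i => \sum_(j < r.+1)
  if (i + j <= r)%N then c i j * x.1 ^+ i * x.2 ^+ j else 0)); last first.
  by move=> i ri; rewrite big1// => j _; rewrite leqNgt ltn_addr.
apply: eq_bigr => i _.
rewrite (sub_ord (fun j => if (i + j <= r)%N then c i j * x.1 ^+ i * x.2 ^+ j else 0)); last first.
  by move=> j rj; rewrite leqNgt ltn_addl.
apply: eq_bigr => j _; case: ifP => ijr; last by rewrite !mul0r if_same.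
by rewrite (leq_trans ijr rs).
Qed.

Lemma Qh_sub_Vh : Qh omega T `<=` Vh omega T.
Proof. by move=> f [cf pf f0]; split=> // i; exact: poly_onS (pf i). Qed.

Lemma Wvec_subspace : subspace_of (Wvec omega T).
Proof.
split=> [k|a w z Ww Wz k].
  rewrite (_ : (fun _ => _) = 0); first exact: (fe_space_subspace 2).1.
  by apply/funext => x; rewrite -[LHS]/((0 : 'cV[R]_2) k 0) mxE.
rewrite (_ : (fun _ => _) = a *: (fun x => w x k 0) + (fun x => z x k 0)).
  by apply: (fe_space_subspace 2).2; [exact: Ww|exact: Wz].
by apply/funext => x; rewrite -[LHS]/((a *: w x + z x) k 0) !mxE.
Qed.

Lemma Vvec_subspace : subspace_of (Vvec omega T).
Proof.
have [W0 WD] := Wvec_subspace.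
split=> [|a w z [Ww w0] [Wz z0]]; split=> // [|x xO]; first exact: WD.
by rewrite -[LHS]/(a *: w x + z x) w0// z0// scaler0 addr0.
Qed.

(** On the cells, the functions are combinations of monomials; a point lying
    in several cells is attributed to one of them. *)
Lemma fe_space_finitely_spanned r : closure omega = \bigcup_i cell (T i) ->
  finitely_spanned (fe_space r omega T).
Proof.
move=> cE.
pose cell_of (x : R * R) := [pick i : 'I_N | `[< cell (T i) x >]].
exists ('I_N * ('I_r.+1 * 'I_r.+1))%type,
  (fun (iab : 'I_N * ('I_r.+1 * 'I_r.+1)) x =>
    if cell_of x == Some iab.1 then x.1 ^+ iab.2.1 * x.2 ^+ iab.2.2 else 0).
move=> f [_ /choice[c fc] f0].
exists (fun iab : 'I_N * ('I_r.+1 * 'I_r.+1) =>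
  if (iab.2.1 + iab.2.2 <= r)%N then c iab.1 iab.2.1 iab.2.2 else 0).
apply/funext => x; rewrite fct_sumE.
rewrite -(pair_bigA _ (fun i (ab : 'I_r.+1 * 'I_r.+1) =>
   (if (ab.1 + ab.2 <= r)%N then c i ab.1 ab.2 else 0) *:
   (if cell_of x == Some i then x.1 ^+ ab.1 * x.2 ^+ ab.2 else 0)))/=.
have : if cell_of x is Some i then cell (T i) x else forall i, ~ cell (T i) x.
  by rewrite /cell_of; case: pickP => [i /asboolP|nx i /asboolP]//; rewrite nx.
case: (cell_of x) => [i ix|nx].
  rewrite (bigD1 i)//= [X in _ + X]big1 ?addr0; last first.
    move=> j ji; have ne : (Some i == Some j) = false.
      by apply/eqP => -[/esym/eqP]; rewrite (negPf ji).
    by rewrite ne big1// => ab _; rewrite scaler0.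
  rewrite eqxx (fc i)//.
  rewrite -(pair_bigA _ (fun a b : 'I_r.+1 => (if (a + b <= r)%N then c i a b else 0) *:
    (x.1 ^+ a * x.2 ^+ b)))/=.
  apply: eq_bigr => a _; rewrite big_mkcond/=; apply: eq_bigr => b _.
  by case: ifP => _; rewrite ?scale0r// [RHS]mulrA.
rewrite f0; last by rewrite cE => -[i _]; exact: nx.
by rewrite big1// => i _; rewrite big1// => ab _; rewrite scaler0.
Qed.

Lemma Wvec_finitely_spanned : closure omega = \bigcup_i cell (T i) ->
  finitely_spanned (Wvec omega T).
Proof.
move=> cE; apply: (@finitely_spanned_images _ _ _ 'I_2
  (fun k (f : R * R -> R) x => f x *: (delta_mx k 0 : 'cV[R]_2)) (Vh omega T)).
- by move=> k a f g; apply/funext => x; rewrite -[LHS]/((a * f x + g x) *: _) scalerDl -scalerA.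
- exact: fe_space_finitely_spanned.
move=> w Ww; exists (fun k x => w x k 0) => //.
apply/funext => x; rewrite fct_sumE; apply/colP => i.
rewrite summxE (bigD1 i)//= [X in _ + X]big1 ?addr0.
  by rewrite !mxE !eqxx mulr1.
by move=> j ji; rewrite !mxE eq_sym (negPf ji) mulr0.
Qed.

Lemma pair_subspace (E : lmodType R) (X : set E) :
  subspace_of X -> subspace_of (X `*` X).
Proof.
move=> [X0 XD]; split=> [|a [x1 x2] [y1 y2] [/= Xx1 Xx2] [/= Xy1 Xy2]]; first by split.
by split; exact: XD.
Qed.

Lemma pair_finitely_spanned (E : lmodType R) (X : set E) :
  finitely_spanned X -> finitely_spanned (X `*` X).
Proof.
move=> fX; apply: (@finitely_spanned_images _ _ _ bool
  (fun b (x : E) => if b then (x, 0) else (0, x)) X) => //.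
- by move=> [] a x y; apply/eqP; rewrite xpair_eqE/= ?scaler0 ?addr0 !eqxx.
move=> [x1 x2] [/= Xx1 Xx2]; exists (fun b : bool => if b then x1 else x2); first by case.
by rewrite big_bool/=; apply/eqP; rewrite xpair_eqE/= addr0 add0r !eqxx.
Qed.

End FiniteElementSpaces.

(** * Bilinear forms given by integrals *)

Section Forms.
Context {R : realType} (omega : set (R * R)) (N : nat) (T : 'I_N -> R * R -> R * R).
Context (msh : triangulated_domain omega T).
Local Notation plane := (measurableTypeR R * measurableTypeR R)%type.
Local Notation area := (@area R).
Local Notation Om0 := (off_skeleton omega T).

Let oOm0 : open Om0. Proof. exact: open_off_skeleton msh. Qed.
Let bOm0 : bounded_set Om0. Proof. exact: bounded_off_skeleton msh. Qed.
Let mOm0 : measurable (Om0 : set plane). Proof. exact: open_measurable_plane. Qed.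

Definition integrable_on_mesh (f : R * R -> R) : Prop :=
  area.-integrable Om0 (EFin \o f).

Lemma Rintegral_sum_mesh (I : Type) (s : seq I) (F : I -> R * R -> R) :
  (forall i, integrable_on_mesh (F i)) ->
  integrable_on_mesh (fun x => \sum_(i <- s) F i x) /\
  \int[area]_(x in Om0) (\sum_(i <- s) F i x) =
  \sum_(i <- s) \int[area]_(x in Om0) F i x.
Proof.
move=> iF; elim: s => [|i s [IHi IHe]].
  rewrite big_nil; under eq_fun do rewrite big_nil; split.
    exact: (bounded_continuous_integrable oOm0 bOm0 (bounded_continuous_cst _ 0)).
  by rewrite Rintegral_cst// mul0r.
under eq_fun do rewrite big_cons; split.
  exact: (integrableD mOm0 (iF i) IHi).
rewrite big_cons -IHe; apply: RintegralD => //; exact: iF.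
Qed.

Section LinearFields.
Context {E : lmodType R} (X : set E).
Implicit Types (L : E -> R * R -> R).

(** Fields depending linearly on an element of [X], away from the skeleton:
    on the skeleton, where derivatives need not exist, nothing can be said. *)
Definition linear_field L : Prop :=
  (forall x, X x -> bounded_continuous Om0 (L x)) /\
  forall a x y, X x -> X y -> forall z, Om0 z -> L (a *: x + y) z = a * L x z + L y z.

Definition linear_mxfield m n (L : E -> R * R -> 'M[R]_(m, n)) : Prop :=
  forall i j, linear_field (fun x z => L x z i j).

Lemma eq_linear_field L L' : (forall x z, L x z = L' x z) ->
  linear_field L -> linear_field L'.
Proof.
move=> LL'; suff -> : L = L' by [].
by apply/funext => x; apply/funext => z.
Qed.

Lemma linear_field_mull c L : bounded_continuous Om0 c -> linear_field L ->
  linear_field (fun x z => c z * L x z).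
Proof.
move=> bc [bL lL]; split=> [x Xx|a x y Xx Xy z Oz].
  exact: bounded_continuousM bc (bL x Xx).
by rewrite lL// mulrDr mulrCA.
Qed.

Lemma linear_field_mulr c L : bounded_continuous Om0 c -> linear_field L ->
  linear_field (fun x z => L x z * c z).
Proof.
by move=> bc lL; apply: eq_linear_field (linear_field_mull bc lL) => x z; rewrite mulrC.
Qed.

Lemma linear_field_sum (I : Type) (s : seq I) (L : I -> E -> R * R -> R) :
  (forall i, linear_field (L i)) -> linear_field (fun x z => \sum_(i <- s) L i x z).
Proof.
move=> lL; split=> [x Xx|a x y Xx Xy z Oz].
  by apply: bounded_continuous_sum => i; exact: (lL i).1.
rewrite mulr_sumr -big_split; apply: eq_bigr => i _.
exact: (lL i).2.
Qed.

Lemma ips_linear c L : integrable_on_mesh c -> linear_field L ->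
  linear_on X (fun y => ips omega c (L y)).
Proof.
move=> ic [bL lL] a x y Xx Xy; rewrite /ips !(Rintegral_off_skeleton msh).
have icL u : X u -> area.-integrable Om0 (EFin \o (fun z => c z * L u z)).
  by move=> Xu; exact: bounded_continuousM_integrable (bL u Xu).
rewrite -RintegralZl ?icL// -RintegralD ?icL//.
  by apply: eq_Rintegral => z /[!inE] Oz; rewrite lL// mulrDr mulrCA.
exact: (integrableZl mOm0 a (icL _ Xx)).
Qed.

Lemma ipsC f g : ips omega f g = ips omega g f.
Proof. by rewrite /ips; under eq_Rintegral do rewrite mulrC. Qed.

Lemma ips_bilinear L L' : linear_field L -> linear_field L' ->
  bilinear_on X (fun x y => ips omega (L x) (L' y)).
Proof.
move=> lL lL'; split=> [y Xy|x Xx].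
  have := ips_linear (bounded_continuous_integrable oOm0 bOm0 (lL'.1 y Xy)) lL.
  by under eq_fun do rewrite ipsC.
exact: ips_linear (bounded_continuous_integrable oOm0 bOm0 (lL.1 x Xx)) lL'.
Qed.

Lemma ipE m n (A B : R * R -> 'M[R]_(m, n)) :
  (forall i j, integrable_on_mesh (fun z => A z i j * B z i j)) ->
  ip omega A B = \sum_i \sum_j ips omega (fun z => A z i j) (fun z => B z i j).
Proof.
move=> iAB; rewrite /ip (Rintegral_off_skeleton msh) /dot.
have iS i := Rintegral_sum_mesh (index_enum 'I_n) (iAB i).
rewrite (Rintegral_sum_mesh _ (fun i => (iS i).1)).2.
apply: eq_bigr => i _; rewrite (iS i).2; apply: eq_bigr => j _.
by rewrite /ips (Rintegral_off_skeleton msh).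
Qed.

Context (sX : subspace_of X).

Lemma eq_linear_on (l l' : E -> R) : (forall y, X y -> l y = l' y) ->
  linear_on X l -> linear_on X l'.
Proof.
by move=> ll' lX a x y Xx Xy; rewrite -!ll'//; [exact: lX|exact: sX.2].
Qed.

Lemma eq_bilinear_on (B B' : E -> E -> R) :
  (forall x y, X x -> X y -> B x y = B' x y) -> bilinear_on X B -> bilinear_on X B'.
Proof.
move=> BB' [Bl Br]; split=> [y Xy|x Xx].
  by apply: eq_linear_on (Bl y Xy) => x Xx; exact: BB'.
by apply: eq_linear_on (Br x Xx) => y Xy; exact: BB'.
Qed.

Lemma linear_on_big (I : Type) (s : seq I) (l : I -> E -> R) :
  (forall i, linear_on X (l i)) -> linear_on X (fun y => \sum_(i <- s) l i y).
Proof.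
move=> ll a x y Xx Xy; rewrite mulr_sumr -big_split; apply: eq_bigr => i _.
exact: ll.
Qed.

Lemma bilinear_on_big (I : Type) (s : seq I) (B : I -> E -> E -> R) :
  (forall i, bilinear_on X (B i)) ->
  bilinear_on X (fun x y => \sum_(i <- s) B i x y).
Proof.
move=> bB; split=> [y Xy|x Xx]; apply: linear_on_big => i.
  exact: (bB i).1.
exact: (bB i).2.
Qed.

Lemma ip_bilinear m n (L L' : E -> R * R -> 'M[R]_(m, n)) :
  linear_mxfield L -> linear_mxfield L' ->
  bilinear_on X (fun x y => ip omega (L x) (L' y)).
Proof.
move=> lL lL'.
apply: (@eq_bilinear_on (fun x y =>
  \sum_i \sum_j ips omega (fun z => L x z i j) (fun z => L' y z i j))).
  move=> x y Xx Xy; rewrite ipE// => i j.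
  apply: bounded_continuous_integrable => //.
  by apply: bounded_continuousM; [exact: (lL i j).1|exact: (lL' i j).1].
apply: bilinear_on_big => i; apply: bilinear_on_big => j.
exact: ips_bilinear.
Qed.

Lemma ip_linear m n (A : R * R -> 'M[R]_(m, n)) (L : E -> R * R -> 'M[R]_(m, n)) :
  (forall i j, integrable_on_mesh (fun z => A z i j)) -> linear_mxfield L ->
  linear_on X (fun y => ip omega A (L y)).
Proof.
move=> iA lL.
apply: (@eq_linear_on (fun y =>
  \sum_i \sum_j ips omega (fun z => A z i j) (fun z => L y z i j))).
  move=> y Xy; rewrite ipE// => i j.
  by apply: bounded_continuousM_integrable => //; [exact: iA|exact: (lL i j).1].
apply: linear_on_big => i; apply: linear_on_big => j.
exact: ips_linear.
Qed.

End LinearFields.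

Lemma linear_field_comp (E F : lmodType R) (X : set E) (Y : set F)
    (phi : E -> F) (L : F -> R * R -> R) :
  (forall x, X x -> Y (phi x)) -> (forall a x y, phi (a *: x + y) = a *: phi x + phi y) ->
  linear_field Y L -> linear_field X (L \o phi).
Proof.
move=> XY lphi [bL lL]; split=> [x Xx|a x y Xx Xy z Oz] /=.
  exact: bL (XY _ Xx).
by rewrite lphi lL//; exact: XY.
Qed.

Lemma linear_field_id : linear_field (Vh omega T) id.
Proof.
by split=> [f fe|//]; exact: (@fe_bounded_continuous _ _ _ _ msh 2 f fe).
Qed.

Lemma linear_field_partial j : linear_field (Vh omega T) (partial j).
Proof.
split=> [f fe|a f g fe ge z Oz]; first exact: (@fe_partial_bounded_continuous _ _ _ _ msh 2 f fe).
have df := @fe_derivable _ _ _ _ msh 2 f fe j z Oz.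
have dg := @fe_derivable _ _ _ _ msh 2 g ge j z Oz.
rewrite /partial deriveD//; last exact: derivableZ.
by rewrite deriveZ.
Qed.

Lemma linear_mxfield_grad : linear_mxfield (Vh omega T) grad.
Proof.
move=> i j; apply: eq_linear_field (linear_field_partial i) => f z.
by rewrite mxE.
Qed.

Lemma linear_field_coord k : linear_field (Wvec omega T) (fun w z => w z k 0).
Proof.
apply: (@linear_field_comp _ _ _ (Vh omega T)
  (fun (w : R * R -> 'cV[R]_2) z => w z k 0) id) => //; last exact: linear_field_id.
by move=> a w w'; apply/funext => z; rewrite !mxE.
Qed.

Lemma linear_mxfield_Wvec : linear_mxfield (Wvec omega T) id.
Proof. by move=> k j; rewrite ord1; exact: linear_field_coord. Qed.

Lemma linear_mxfield_Grad : linear_mxfield (Wvec omega T) Grad.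
Proof.
move=> k j.
have := @linear_field_comp _ _ (Wvec omega T) (Vh omega T)
  (fun (w : R * R -> 'cV[R]_2) z => w z k 0) (partial j).
move=> h; have {}h : linear_field (Wvec omega T)
    (partial j \o (fun (w : R * R -> 'cV[R]_2) z => w z k 0)).
  apply: h => //; last exact: linear_field_partial.
  by move=> a w w'; apply/funext => z; rewrite !mxE.
by apply: eq_linear_field h => w z; rewrite !mxE.
Qed.

Lemma linear_field_div : linear_field (Wvec omega T) div.
Proof. by apply: linear_field_sum => i; exact: linear_mxfield_Grad. Qed.

End Forms.

(** * Skew-symmetry of transport *)

Section SkewSymmetry.
Context {R : realType} (omega : set (R * R)) (N : nat) (T : 'I_N -> R * R -> R * R).
Context (msh : triangulated_domain omega T).
Local Notation plane := (measurableTypeR R * measurableTypeR R)%type.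
Local Notation area := (@area R).
Local Notation Om0 := (off_skeleton omega T).

Let oOm0 : open Om0. Proof. exact: open_off_skeleton msh. Qed.
Let bOm0 : bounded_set Om0. Proof. exact: bounded_off_skeleton msh. Qed.
Let mOm0 : measurable (Om0 : set plane). Proof. exact: open_measurable_plane. Qed.
Let oomega : open omega. Proof. by case: msh. Qed.
Let tri : conforming_triangulation omega T. Proof. by case: msh. Qed.

(** The cells and the complement of [omega] form a closed cover of the plane, and
    [g] is Lipschitz on each of its members. The skeleton contains all the points
    where [g] may fail to be derivable, also those outside [omega]. *)
Lemma integral_partial_piecewise_smooth (g : R * R -> R) (p : 'I_N -> R * R -> R) j :
  (forall i, smooth (p i)) -> (forall i x, cell (T i) x -> g x = p i x) ->
  (forall x, ~ omega x -> g x = 0) -> \int[area]_(x in Om0) partial j g x = 0.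
Proof.
move=> sp gp g0; have [M OM] := bounded_closure_omega msh.
have [_ cE _] := tri.
have cM i x : cell (T i) x -> `|x| <= M.
  by move=> ix; apply: OM; exact: (cell_sub_closure msh) ix.
have /choice[L LP] i : exists L, 0 <= L /\ forall x y, `|x| <= M -> `|y| <= M ->
    `|p i x - p i y| <= L * `|x - y|.
  by have [_ _ _ /(_ M)[L L0 lp]] := sp i; exists L.
have /choice[K KP] i : exists K, forall x, `|x| <= M -> `|p i x| <= K.
  by apply: continuous_bounded_ball; have [] := sp i.
have L0 : 0 <= \sum_i L i by rewrite sumr_ge0// => i _; have [] := LP i.
have K0 : 0 <= \sum_i `|K i| by rewrite sumr_ge0.
pose C (o : option 'I_N) := if o is Some i then cell (T i) else ~` omega.
have in_cell x : omega x -> exists i, cell (T i) x.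
  by move=> /(@subset_closure _ _ x); rewrite cE => -[i _]; exists i.
have lbs : lipschitz_bounded_support g (\sum_i L i) (\sum_i `|K i|) M.
  split=> // [|x|x Mx].
  - apply: (@lipschitz_pasting _ _ g C) => //.
    + case=> [i|]; first exact: closed_cell msh _.
      exact: open_closedC.
    + apply/seteqP; split=> // x _; have [/in_cell[i ix]|] := pselect (omega x).
        by exists (Some i).
      by exists None.
    + case=> [i|] x y /= Cx Cy; last first.
        by rewrite !g0// subrr normr0 mulr_ge0.
      rewrite !(gp i)// (le_trans ((LP i).2 _ _ (cM _ _ Cx) (cM _ _ Cy)))//.
      apply: ler_wpM2r => //; rewrite (bigD1 i)//= lerDl sumr_ge0// => k _.
      by have [] := LP k.
  - have [/in_cell[i ix]|/g0 ->] := pselect (omega x); last by rewrite normr0.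
    rewrite (gp i)// (le_trans (KP i _ (cM _ _ ix)))//.
    by rewrite (bigD1 i)//= (le_trans (ler_norm _))// lerDl sumr_ge0.
  - apply: g0 => /(@subset_closure _ _ x)/OM.
    by rewrite leNgt Mx.
rewrite /off_skeleton /partial.
apply: (integral_derive_vanishing_outside lbs (measurable_skeleton T) (area_skeleton msh)) => //.
  move=> x nx; have [cx|ncx] := pselect (closure omega x).
    move: cx; rewrite cE => -[i _ ix].
    have iix : interior (cell (T i)) x.
      apply: contrapT => nix; apply: nx; exists i => //; split=> //.
      exact: subset_closure.
    have [dp _ _ _] := sp i; apply: near_eq_derivable (dp j x).
    by apply: filterS iix => y iy; rewrite (gp i).
  apply: near_eq_derivable (derivable_cst 0 x (e_ j)).
  have oC : open (~` closure omega) by apply: closed_openC; exact: closed_closure.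
  have : \forall y \near x, ~ closure omega y by exact: open_nbhs_nbhs (conj oC ncx).
  by apply: filterS => y ny; rewrite g0// => /(@subset_closure _ _ y).
exact: open_measurable_plane.
Qed.

Lemma integral_partial_sqr_mul (r w : R * R -> R) j : Vh omega T r -> Vh omega T w ->
  (forall x, frontier omega x -> w x = 0) ->
  \int[area]_(x in Om0) partial j (fun x => r x * r x * w x) x = 0.
Proof.
move=> Vr Vw w0.
have [p pP] := fe_smooth Vr; have [q qP] := fe_smooth Vw.
apply: (@integral_partial_piecewise_smooth _ (fun i x => p i x * p i x * q i x)) => [i|i x ix|x nx].
- have [sp _] := pP i; have [sq _] := qP i.
  by apply: smoothM => //; exact: smoothM.
- by rewrite (pP i).2// (qP i).2.
- rewrite (_ : w x = 0) ?mulr0//; have [cx|ncx] := pselect (closure omega x).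
    apply: w0; split=> // ix; apply: nx; exact: interior_subset ix.
  by have [_ _] := Vw; apply.
Qed.

Lemma Rintegral_eqD (f g h : R * R -> R) : integrable_on_mesh omega T f ->
  integrable_on_mesh omega T g -> (forall x, Om0 x -> h x = f x + g x) ->
  \int[area]_(x in Om0) h x = \int[area]_(x in Om0) f x + \int[area]_(x in Om0) g x.
Proof.
move=> fi gi hE; rewrite -RintegralD//.
by apply: eq_Rintegral => x /[!inE]; exact: hE.
Qed.

(** This is [2 * r * (v . grad r) + (div v) * r ^ 2 = div (r ^ 2 v)]: the flux
    of [r ^ 2 v] through the boundary vanishes with [v]. *)
Lemma transport_skew (v : R * R -> 'cV[R]_2) (r : R * R -> R) :
  Vvec omega T v -> Vh omega T r ->
  \sum_j ips omega (fun z => r z * v z j 0) (partial j r)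
    + 2^-1 * ips omega (fun z => div v z * r z) r = 0.
Proof.
move=> [Wv v0] Vr.
have bc f : Vh omega T f -> bounded_continuous Om0 f by exact: (linear_field_id msh).1.
have bcp j f : Vh omega T f -> bounded_continuous Om0 (partial j f).
  exact: (linear_field_partial msh j).1.
have bi f : bounded_continuous Om0 f -> area.-integrable Om0 (EFin \o f).
  exact: bounded_continuous_integrable.
pose V j : R * R -> R := fun z => v z j 0.
have VV j : Vh omega T (V j) by exact: Wv.
have key j : ips omega (fun z => r z * V j z) (partial j r)
    + 2^-1 * ips omega (fun z => partial j (V j) z * r z) r = 0.
  have V0 x : frontier omega x -> V j x = 0 by move=> /v0; rewrite /V => ->; rewrite mxE.
  have := integral_partial_sqr_mul j Vr (VV j) V0.
  move/(congr1 (fun t => 2^-1 * t)); rewrite mulr0 => <-.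
  rewrite /ips !(Rintegral_off_skeleton msh).
  have b1 := bounded_continuousM (bounded_continuousM (bc _ Vr) (bc _ (VV j))) (bcp j _ Vr).
  have b2 := bounded_continuousM (bounded_continuousM (bcp j _ (VV j)) (bc _ Vr)) (bc _ Vr).
  rewrite (@Rintegral_eqD (fun z => 2 * (r z * V j z * partial j r z))
    (fun z => partial j (V j) z * r z * r z)
    (partial j (fun x => r x * r x * V j x))).
  - by rewrite RintegralZl ?bi// mulrDr mulrA mulVf ?mul1r// pnatr_eq0.
  - exact: (integrableZl mOm0 2 (bi _ b1)).
  - exact: bi.
  - move=> x Ox.
    have dr := @fe_derivable _ _ _ _ msh 2 r Vr j x Ox.
    have dV := @fe_derivable _ _ _ _ msh 2 (V j) (VV j) j x Ox.
    have drr : derivable (fun x => r x * r x) x (e_ j) by exact: derivableM.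
    rewrite /partial.
    have -> : 'D_(e_ j) (fun x => r x * r x * V j x) x =
        r x * r x * 'D_(e_ j) (V j) x + V j x * 'D_(e_ j) (fun x => r x * r x) x.
      exact: (deriveM drr dV).
    have -> : 'D_(e_ j) (fun x => r x * r x) x =
        r x * 'D_(e_ j) r x + r x * 'D_(e_ j) r x by exact: (deriveM dr dr).
    ring.
have <- : \sum_j ips omega (fun z => partial j (V j) z * r z) r =
    ips omega (fun z => div v z * r z) r.
  rewrite /ips !(Rintegral_off_skeleton msh).
  under eq_bigr do rewrite (Rintegral_off_skeleton msh).
  rewrite -(Rintegral_sum_mesh msh _ _).2.
    apply: eq_Rintegral => z _; rewrite /div /mxtrace !mulr_suml.
    by apply: eq_bigr => j _; rewrite mxE.
  move=> j; apply: bi.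
  exact: bounded_continuousM (bounded_continuousM (bcp j _ (VV j)) (bc _ Vr)) (bc _ Vr).
by rewrite mulr_sumr -big_split big1// => j _; exact: key.
Qed.

End SkewSymmetry.

(** * Definiteness of the energies *)

Section Coercivity.
Context {R : realType} (omega : set (R * R)) (N : nat) (T : 'I_N -> R * R -> R * R).
Context (msh : triangulated_domain omega T).
Local Notation Om0 := (off_skeleton omega T).

Let oOm0 : open Om0. Proof. exact: open_off_skeleton msh. Qed.
Let bOm0 : bounded_set Om0. Proof. exact: bounded_off_skeleton msh. Qed.
Let tri : conforming_triangulation omega T. Proof. by case: msh. Qed.

Lemma dot_ge0 m n (A : 'M[R]_(m, n)) : 0 <= dot A A.
Proof. by rewrite sumr_ge0// => i _; rewrite sumr_ge0// => j _; rewrite -expr2 sqr_ge0. Qed.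

Lemma dot_eq0 m n (A : 'M[R]_(m, n)) : dot A A = 0 -> A = 0.
Proof.
move=> /eqP; rewrite psumr_eq0; last first.
  by move=> i _; rewrite sumr_ge0// => j _; rewrite -expr2 sqr_ge0.
move=> /allP A0; apply/matrixP => i j; rewrite mxE.
have := A0 i (mem_index_enum i); rewrite psumr_eq0/=; last first.
  by move=> k _; rewrite -expr2 sqr_ge0.
by move=> /allP/(_ j (mem_index_enum j)); rewrite /= -expr2 sqrf_eq0 => /eqP.
Qed.

Lemma ips_ge0 (f : R * R -> R) : 0 <= ips omega f f.
Proof. by rewrite Rintegral_ge0// => x _; rewrite -expr2 sqr_ge0. Qed.

Lemma ip_weighted_ge0 (c : R * R -> R) m n (A : R * R -> 'M[R]_(m, n)) :
  (forall x, 0 <= c x) -> 0 <= ip omega (fun x => c x *: A x) A.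
Proof.
move=> c0; rewrite Rintegral_ge0// => x _.
rewrite (_ : dot _ _ = c x * dot (A x) (A x)) ?mulr_ge0 ?dot_ge0//.
rewrite /dot mulr_sumr; apply: eq_bigr => i _; rewrite mulr_sumr.
by apply: eq_bigr => j _; rewrite mxE mulrA.
Qed.

Lemma ip_self_ge0 m n (A : R * R -> 'M[R]_(m, n)) : 0 <= ip omega A A.
Proof. by rewrite Rintegral_ge0// => x _; exact: dot_ge0. Qed.

Lemma ip_self_eq0 m n (A : R * R -> 'M[R]_(m, n)) :
  (forall i j, bounded_continuous Om0 (fun x => A x i j)) ->
  ip omega A A = 0 -> forall x, Om0 x -> A x = 0.
Proof.
move=> bA; rewrite /ip (Rintegral_off_skeleton msh) => I0 x Ox.
apply: dot_eq0; move: x Ox.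
apply: (Rintegral_eq0_bounded_continuous oOm0 bOm0 _ _ I0) => [|x _].
  apply: bounded_continuous_sum => i; apply: bounded_continuous_sum => j.
  exact: bounded_continuousM.
exact: dot_ge0.
Qed.

Lemma ips_eq0 (f : R * R -> R) : Vh omega T f -> ips omega f f = 0 -> f = 0.
Proof.
move=> Vf; rewrite /ips (Rintegral_off_skeleton msh) => I0.
apply: (@fe_eq0 _ _ _ _ msh 2 f Vf) => x Ox; apply/eqP; rewrite -sqrf_eq0 expr2; apply/eqP.
move: x Ox.
apply: (Rintegral_eq0_bounded_continuous oOm0 bOm0 _ _ I0) => [|x _].
  by apply: bounded_continuousM; exact: (linear_field_id msh).1.
by rewrite -expr2 sqr_ge0.
Qed.

Lemma ip_eq0_Wvec (w : R * R -> 'cV[R]_2) : Wvec omega T w -> ip omega w w = 0 -> w = 0.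
Proof.
move=> Ww w0; apply/funext => x; apply/colP => k.
have bw i j : bounded_continuous Om0 (fun x => w x i j).
  exact: (linear_mxfield_Wvec msh i j).1.
have w0' := ip_self_eq0 bw w0.
have h : (fun x => w x k 0) = fun=> 0.
  by apply: (@fe_eq0 _ _ _ _ msh 2 _ (Ww k)) => z Oz; rewrite /= (w0' z Oz) mxE.
by rewrite -[RHS]/((0 : 'cV[R]_2) k 0) mxE; exact: (congr1 (@^~ x) h).
Qed.

Lemma poly1_partial (c : nat -> nat -> R) (x : R * R) :
  let p := fun x : R * R => \sum_(i < 2) \sum_(j < 2 | (i + j <= 1)%N)
            c i j * x.1 ^+ i * x.2 ^+ j in
  (forall x, p x = c 0%N 0%N + c 0%N 1%N * x.2 + c 1%N 0%N * x.1) /\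
  (partial 0 p x = c 1%N 0%N /\ partial 1 p x = c 0%N 1%N).
Proof.
move=> p; have pE y : p y = c 0%N 0%N + c 0%N 1%N * y.2 + c 1%N 0%N * y.1.
  rewrite /p; under eq_bigr do rewrite big_mkcond/= !big_ord_recl big_ord0/=.
  by rewrite !big_ord_recl big_ord0/= !expr0 !expr1; ring.
split=> //.
have d j : 'D_(e_ j) p x = c 0%N 1%N * (e_ j).2 + c 1%N 0%N * (e_ j).1.
  have -> : p = (cst (c 0%N 0%N) + (c 0%N 1%N *: (snd : R * R -> R)))
      + c 1%N 0%N *: (fst : R * R -> R) by apply/funext => y; rewrite pE.
  have d1 := @linear_is_derive R fst j x (fun _ _ _ => erefl).
  have d2 := @linear_is_derive R snd j x (fun _ _ _ => erefl).
  have [_ ->] := is_deriveD (is_deriveD (is_derive_cst (c 0%N 0%N) x (e_ j))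
    (is_deriveZ (c 0%N 1%N) d2)) (is_deriveZ (c 1%N 0%N) d1).
  by rewrite add0r.
by rewrite /partial !d /e_/= !mulr0 !mulr1 addr0 add0r.
Qed.

(** A cell with interior points has some off the skeleton, so the affine function
    is constant on it. Such cells contain all the points off the skeleton, hence
    cover the domain. So the function takes finitely many values, each on a
    relatively closed set, and the domain is connected. *)
Lemma fe1_grad_eq0_cst (f : R * R -> R) : fe_space 1 omega T f ->
  (forall x j, Om0 x -> partial j f x = 0) ->
  exists c, forall x, omega x -> f x = c.
Proof.
move=> fe f0; have [_ _ [x0 Ox0] comega _] := msh.
have [_ cE _] := tri; have [_ pf _] := fe.
pose fat i := interior (cell (T i)) !=set0.
have cst i : exists c, fat i -> forall x, cell (T i) x -> f x = c.
  have [[y iy]|] := pselect (fat i); last by exists 0.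
  have [x [[Ox ix] O0x]] : omega `&` interior (cell (T i)) `&` Om0 !=set0.
    have [z [Oz iz]] : omega `&` interior (cell (T i)) !=set0.
      apply: (cell_sub_closure msh (interior_subset iy)).
      by apply: open_nbhs_nbhs; split=> //; exact: open_interior.
    have [w [Ow [Oz' iz']]] : Om0 `&` (omega `&` interior (cell (T i))) !=set0.
      apply: (off_skeleton_dense msh Oz); apply: open_nbhs_nbhs; split=> //.
      by apply: openI; [case: msh|exact: open_interior].
    by exists w.
  have [c fc] := pf i; have [pE [p1 p2]] := poly1_partial c x.
  exists (c 0%N 0%N) => _ z iz; rewrite fc// pE.
  have := f0 x 0 O0x; have := f0 x 1 O0x.
  rewrite (fe_partial _ fc ix) (fe_partial _ fc ix) p1 p2 => -> ->.
  by rewrite !mul0r !addr0.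
have /choice[c cP] := cst.
have clF (P : 'I_N -> Prop) : closed (\bigcup_(i in P) cell (T i)).
  by apply: closed_bigcup => [|i _]; [exact: finite_finset|exact: closed_cell msh _].
have cover x : omega x -> exists2 i, fat i & cell (T i) x.
  move=> Ox; have : (\bigcup_(i in fat) cell (T i)) x.
    apply: (clF fat); have := off_skeleton_dense msh Ox; apply: closureS => y Oy.
    have [i iy] := off_skeleton_interior msh Oy; exists i; first by exists y.
    exact: interior_subset iy.
  by move=> [i ? ?]; exists i.
exists (f x0); pose B := omega `&` [set x | f x = f x0].
suff -> : omega = B by move=> x [].
apply/esym/comega; first by exists x0.
- exists (~` \bigcup_(i in [set i | fat i /\ c i != f x0]) cell (T i)).
    exact: closed_openC.
  apply/seteqP; split=> x [Ox] /=.
    by move=> fx; split=> // -[i [fi /eqP ci] ix]; apply: ci; rewrite -fx (cP i fi).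
  move=> nx; split=> //; have [i fi ix] := cover x Ox.
  apply: contrapT => /eqP fx; apply: nx; exists i => //; split=> //.
  by rewrite -(cP i fi _ ix).
- exists (\bigcup_(i in [set i | fat i /\ c i = f x0]) cell (T i)); first exact: clF.
  apply/seteqP; split=> x [Ox] /=.
    move=> fx; split=> //; have [i fi ix] := cover x Ox.
    by exists i => //; split=> //; rewrite -(cP i fi _ ix).
  by move=> [i [fi ci] ix]; split=> //; rewrite /= (cP i fi x ix).
Qed.

End Coercivity.

(** * Coefficients and forms of the scheme *)

Section TimeStep.
Context {R : realType} (omega : set (R * R)) (N : nat) (T : 'I_N -> R * R -> R * R).
Context (msh : triangulated_domain omega T).
Local Notation plane := (measurableTypeR R * measurableTypeR R)%type.
Local Notation area := (@area R).
Local Notation Om0 := (off_skeleton omega T).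

Let oOm0 : open Om0. Proof. exact: open_off_skeleton msh. Qed.
Let bOm0 : bounded_set Om0. Proof. exact: bounded_off_skeleton msh. Qed.
Let mOm0 : measurable (Om0 : set plane). Proof. exact: open_measurable_plane. Qed.

Definition bounded_continuous_mx m n (A : R * R -> 'M[R]_(m, n)) : Prop :=
  forall i j, bounded_continuous Om0 (fun x => A x i j).

Lemma bounded_continuous_mxZ (c : R * R -> R) m n (A : R * R -> 'M[R]_(m, n)) :
  bounded_continuous Om0 c -> bounded_continuous_mx A ->
  bounded_continuous_mx (fun x => c x *: A x).
Proof.
move=> bc bA i j; under eq_fun do rewrite mxE.
exact: bounded_continuousM.
Qed.

Lemma bounded_continuous_mxM m n p (A : R * R -> 'M[R]_(m, n)) (B : R * R -> 'M[R]_(n, p)) :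
  bounded_continuous_mx A -> bounded_continuous_mx B ->
  bounded_continuous_mx (fun x => A x *m B x).
Proof.
move=> bA bB i j; under eq_fun do rewrite mxE.
by apply: bounded_continuous_sum => k; exact: bounded_continuousM.
Qed.

Lemma bounded_continuous_dot m n (A B : R * R -> 'M[R]_(m, n)) :
  bounded_continuous_mx A -> bounded_continuous_mx B ->
  bounded_continuous Om0 (fun x => dot (A x) (B x)).
Proof.
move=> bA bB; apply: bounded_continuous_sum => i; apply: bounded_continuous_sum => j.
exact: bounded_continuousM.
Qed.

Lemma Vh_bounded_continuous f : Vh omega T f -> bounded_continuous Om0 f.
Proof. exact: (linear_field_id msh).1. Qed.

Lemma grad_bounded_continuous f : Vh omega T f -> bounded_continuous_mx (grad f).
Proof. by move=> Vf i j; exact: (linear_mxfield_grad msh i j).1. Qed.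

Lemma Wvec_bounded_continuous w : Wvec omega T w -> bounded_continuous_mx w.
Proof. by move=> Ww i j; exact: (linear_mxfield_Wvec msh i j).1. Qed.

Lemma Grad_bounded_continuous w : Wvec omega T w -> bounded_continuous_mx (Grad w).
Proof. by move=> Ww i j; exact: (linear_mxfield_Grad msh i j).1. Qed.

Lemma div_bounded_continuous w : Wvec omega T w -> bounded_continuous Om0 (div w).
Proof. exact: (linear_field_div msh).1. Qed.

Lemma bounded_continuous_on_mesh f : bounded_continuous Om0 f -> integrable_on_mesh omega T f.
Proof. exact: bounded_continuous_integrable. Qed.

(** From [|f| <= 1 + f ^ 2], as the domain has finite area. *)
Lemma L2_integrable_on_mesh f : L2 omega f -> integrable_on_mesh omega T f.
Proof.
move=> [mf if2].
have mom : measurable (omega : set plane) by apply: open_measurable_plane; case: msh.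
have i1 : integrable_on_mesh omega T (fun=> 1).
  exact: bounded_continuous_on_mesh (bounded_continuous_cst _ 1).
have i2 : integrable_on_mesh omega T (fun x => f x ^+ 2).
  by apply: integrableS if2 => // x [].
apply: (le_integrable mOm0 _ _ (integrableD mOm0 i1 i2)).
  by apply/measurable_EFinP; apply: (measurable_funS mom _ mf) => x [].
move=> x Ox /=; rewrite lee_fin [leRHS]ger0_norm ?addr_ge0 ?sqr_ge0//.
have := sqr_ge0 (`|f x| - 1); rewrite -[X in _ <= 1 + X]real_normK ?num_real//.
by rewrite sqrrB1; have := normr_ge0 (f x); nra.
Qed.

Lemma integrable_on_meshZ c f : integrable_on_mesh omega T f ->
  integrable_on_mesh omega T (fun x => c * f x).
Proof. exact: integrableZl. Qed.

Section Fields.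
Context {E : lmodType R} (X : set E).

Lemma linear_mxfieldZ c m n (L : E -> R * R -> 'M[R]_(m, n)) :
  bounded_continuous Om0 c -> linear_mxfield omega T X L ->
  linear_mxfield omega T X (fun w x => c x *: L w x).
Proof.
move=> bc lL i j.
by apply: eq_linear_field (linear_field_mull bc (lL i j)) => w z; rewrite mxE.
Qed.

Lemma linear_mxfieldMr m n p (L : E -> R * R -> 'M[R]_(m, n)) (B : R * R -> 'M[R]_(n, p)) :
  linear_mxfield omega T X L -> bounded_continuous_mx B ->
  linear_mxfield omega T X (fun w x => L w x *m B x).
Proof.
move=> lL bB i j.
have := linear_field_sum (index_enum 'I_n) (fun k => linear_field_mulr (bB k j) (lL i k)).
by apply: eq_linear_field => w z; rewrite mxE.
Qed.

Lemma linear_fieldZmx (L : E -> R * R -> R) m n (A : R * R -> 'M[R]_(m, n)) :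
  linear_field omega T X L -> bounded_continuous_mx A ->
  linear_mxfield omega T X (fun w x => L w x *: A x).
Proof.
move=> lL bA i j.
by apply: eq_linear_field (linear_field_mulr (bA i j) lL) => w z; rewrite mxE.
Qed.

Lemma linear_fieldS (Y : set E) (L : E -> R * R -> R) :
  X `<=` Y -> linear_field omega T Y L -> linear_field omega T X L.
Proof.
move=> XY [bL lL]; split=> [x /XY|a x y /XY Yx /XY Yy]; [exact: bL|exact: lL].
Qed.

Lemma linear_mxfieldS (Y : set E) m n (L : E -> R * R -> 'M[R]_(m, n)) :
  X `<=` Y -> linear_mxfield omega T Y L -> linear_mxfield omega T X L.
Proof. by move=> XY lL i j; exact: linear_fieldS (lL i j). Qed.

End Fields.

Lemma truncation_bounds (s : R) : 0 <= truncation s <= 1.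
Proof.
by rewrite /truncation le_min ler01/= le_max lexx ge_min lexx.
Qed.

Lemma truncation_continuous : continuous (@truncation R).
Proof.
have lip (s t : R) : `|truncation s - truncation t| <= `|s - t|.
  have h1 := ler_norm (s - t); have h2 := ler_norm (t - s).
  rewrite distrC in h2; rewrite /truncation /Num.min /Num.max ler_norml.
  by do !case: ifPn; rewrite -?leNgt => *; lra.
move=> s; apply/cvgrPdist_lt => e e0; near=> t.
rewrite (le_lt_trans (lip s t))//; near: t.
Unshelve. all: by end_near. Qed.

Lemma hat_bounded_continuous phi : bounded_continuous Om0 phi ->
  bounded_continuous Om0 (hat phi).
Proof.
move=> [cphi _]; split=> [x Ox|].
  apply: (@continuous_comp _ _ _ phi truncation); first exact: cphi.
  exact: truncation_continuous.
exists 1 => x _; have /andP[h0 h1] := truncation_bounds (phi x).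
by rewrite ger0_norm.
Qed.

Lemma comp_hat_bounded_continuous (g : R -> R) phi : continuous g ->
  bounded_continuous Om0 phi -> bounded_continuous Om0 (fun x => g (hat phi x)).
Proof.
move=> cg bphi; apply: (@bounded_continuous_comp _ _ (hat phi) g 0 1) => //.
  by move=> x _; exact: truncation_bounds.
exact: hat_bounded_continuous.
Qed.

Lemma C1_line_continuous (g : R -> R) : C1_line g -> continuous g.
Proof.
move=> [dg _] s; apply: differentiable_continuous; exact/derivable1_diffP.
Qed.

Lemma b_phi_skew v r : Vvec omega T v -> Vh omega T r -> b_phi omega v r r = 0.
Proof.
move=> Vv Vr; have [Wv _] := Vv; rewrite /b_phi -opprD.
apply/eqP; rewrite oppr_eq0; apply/eqP; rewrite -[RHS](transport_skew msh Vv Vr).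
congr (_ + _); rewrite (ipE msh).
  apply: eq_bigr => i _; rewrite big_ord1 /ips.
  by apply: eq_Rintegral => x _; rewrite !mxE.
move=> i j; apply: bounded_continuous_on_mesh; apply: bounded_continuousM.
  apply: bounded_continuous_mxZ; first exact: Vh_bounded_continuous.
  exact: Wvec_bounded_continuous.
exact: grad_bounded_continuous.
Qed.

Lemma transport_self_eq0 v z : Vvec omega T v -> Wvec omega T z -> transport omega v z z = 0.
Proof.
move=> Vv Wz; have [Wv _] := Vv.
have bz := Wvec_bounded_continuous Wz; have bv := Wvec_bounded_continuous Wv.
have bG := Grad_bounded_continuous Wz; have bd := div_bounded_continuous Wv.
rewrite /transport (ipE msh); last first.
  move=> i j; apply: bounded_continuous_on_mesh; apply: bounded_continuousM => //.
  exact: bounded_continuous_mxM.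
rewrite (ipE msh); last first.
  move=> i j; apply: bounded_continuous_on_mesh; apply: bounded_continuousM => //.
  exact: bounded_continuous_mxZ.
rewrite mulr_sumr -big_split big1// => k _.
rewrite /= !big_ord1 -[RHS](transport_skew msh Vv (Wz k)); congr (_ + _ * _).
  rewrite /ips (Rintegral_off_skeleton msh).
  under [RHS]eq_bigr do rewrite (Rintegral_off_skeleton msh).
  rewrite -(Rintegral_sum_mesh msh _ _).2.
    apply: eq_Rintegral => x _; rewrite mxE mulr_suml; apply: eq_bigr => j _.
    by rewrite mxE; ring.
  move=> j; apply: bounded_continuous_on_mesh.
  apply: bounded_continuousM; first exact: bounded_continuousM.
  have := bG k j; by under eq_fun do rewrite mxE.
by apply: eq_Rintegral => x _; rewrite mxE.
Qed.

Lemma b_phi_bilinear v : Vvec omega T v -> bilinear_on (Vh omega T) (b_phi omega v).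
Proof.
move=> [Wv _]; apply: bilinear_onD.
  apply: bilinear_onN; apply: (ip_bilinear msh); first exact: fe_space_subspace.
    apply: linear_fieldZmx; first exact: linear_field_id.
    exact: Wvec_bounded_continuous.
  exact: linear_mxfield_grad.
apply: bilinear_onN; apply: bilinear_onM; apply: (ips_bilinear msh).
  by apply: linear_field_mull; [exact: div_bounded_continuous|exact: linear_field_id].
exact: linear_field_id.
Qed.

Lemma transport_bilinear v X : subspace_of X -> X `<=` Wvec omega T ->
  Vvec omega T v -> bilinear_on X (transport omega v).
Proof.
move=> sX XW [Wv _]; apply: bilinear_onD.
  apply: (ip_bilinear msh sX).
    apply: linear_mxfieldMr; last exact: Wvec_bounded_continuous.
    exact: linear_mxfieldS XW (linear_mxfield_Grad msh).
  exact: linear_mxfieldS XW (linear_mxfield_Wvec msh).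
apply: bilinear_onM; apply: (ip_bilinear msh sX).
  apply: linear_mxfieldZ; first exact: div_bounded_continuous.
  exact: linear_mxfieldS XW (linear_mxfield_Wvec msh).
exact: linear_mxfieldS XW (linear_mxfield_Wvec msh).
Qed.

End TimeStep.

(** * The four subproblems *)

Section Steps.
Context {R : realType} (omega : set (R * R)) (N : nat) (T : 'I_N -> R * R -> R * R).
Context (msh : triangulated_domain omega T).
Context (P : parameters R) (adm : admissible_parameters P).
Local Notation area := (@area R).
Local Notation Om0 := (off_skeleton omega T).
Local Notation V := (Vh omega T).
Local Notation WW := (Wvec omega T).
Local Notation VV := (Vvec omega T).
Local Notation Q0 := (Qh0 omega T).

Let closure_omegaE : closure omega = \bigcup_i cell (T i).
Proof. by have [_ _ _ _ []] := msh. Qed.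

Let sV : subspace_of V. Proof. exact: fe_space_subspace. Qed.
Let fV : finitely_spanned V. Proof. exact: fe_space_finitely_spanned. Qed.

Lemma eq_exists_unique (E : Type) (A B : E -> Prop) :
  (forall x, A x <-> B x) -> (exists! x, A x) -> exists! x, B x.
Proof.
move=> AB [x [Ax Au]]; exists x; split; first exact/AB.
by move=> y /AB; exact: Au.
Qed.

Lemma ips_subl (f g h : R * R -> R) c : V f -> V g -> V h ->
  ips omega (fun x => (f x - g x) / c) h = c^-1 * ips omega f h - c^-1 * ips omega g h.
Proof.
move=> Vf Vg Vh; have [Bl _] := ips_bilinear msh (linear_field_id msh) (linear_field_id msh).
have -> : (fun x => (f x - g x) / c) = c^-1 *: (- 1 *: g + f).
  by apply/funext => x; rewrite -[RHS]/(c^-1 * (- 1 * g x + f x)) mulN1r addrC mulrC.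
rewrite (linear_onZ _ sV (Bl h Vh)); last exact: sV.2.
by rewrite (Bl h Vh)// mulN1r mulrDr mulrN addrC.
Qed.

Lemma ipC m n (A B : R * R -> 'M[R]_(m, n)) : ip omega A B = ip omega B A.
Proof.
apply: eq_Rintegral => x _; apply: eq_bigr => i _; apply: eq_bigr => j _.
exact: mulrC.
Qed.

(** For the homogeneous equations, testing the first one with [ph] and the second
    one with [xi] gives [|ph|^2 / dt = - tau * G] and [|xi|^2 = lambda * G], where
    [G] is the product of the two gradients; so [G = 0], and both norms vanish. *)
Lemma CH_wellposed v phi zeta obs :
  continuous (derive1 (prm_F P)) -> VV v -> V phi -> WW zeta ->
  integrable_on_mesh omega T obs ->
  exists! sol, CH_solution omega T P v phi zeta obs sol.
Proof.
move=> cF Vv Vphi Wzeta iobs.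
have [[_ _ lam0 _] [tau0 _ dt0] _ [_ cnu _]] := adm.
have bF : bounded_continuous Om0 (fun x => derive1 (prm_F P) (hat phi x)).
  by apply: comp_hat_bounded_continuous => //; exact: Vh_bounded_continuous.
have bnu : bounded_continuous Om0
    (fun x => derive1 (prm_nu P) (hat phi x) * normsq_Grad zeta x).
  apply: bounded_continuousM.
    apply: comp_hat_bounded_continuous; last exact: Vh_bounded_continuous.
    by case: cnu => -[].
  by apply: bounded_continuous_dot; exact: Grad_bounded_continuous.
have Lid := linear_field_id msh; have Lgrad := linear_mxfield_grad msh.
have ips_bil := ips_bilinear msh Lid Lid.
have grad_bil := ip_bilinear msh sV Lgrad Lgrad.
pose B1 (x : (R * R -> R) * (R * R -> R)) th := (prm_dt P)^-1 * ips omega x.1 th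
  + b_phi omega v x.1 th + prm_tau P * ip omega (grad x.2) (grad th).
pose B2 (x : (R * R -> R) * (R * R -> R)) ch :=
  ips omega x.2 ch - prm_lambda P * ip omega (grad x.1) (grad ch).
pose l1 th := (prm_dt P)^-1 * ips omega phi th
  + ips omega (fun x => prm_alpha_phi P * obs x) th.
pose l2 ch := prm_lambda P * prm_gamma P *
    ips omega (fun x => derive1 (prm_F P) (hat phi x)) ch
  + 2^-1 * ips omega (fun x => derive1 (prm_nu P) (hat phi x) * normsq_Grad zeta x) ch.
have fstV : forall x : (R * R -> R) * (R * R -> R), (V `*` V) x -> V x.1 by move=> ? [].
have sndV : forall x : (R * R -> R) * (R * R -> R), (V `*` V) x -> V x.2 by move=> ? [].
have fstL a (x y : (R * R -> R) * (R * R -> R)) : (a *: x + y).1 = a *: x.1 + y.1 by [].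
have sndL a (x y : (R * R -> R) * (R * R -> R)) : (a *: x + y).2 = a *: x.2 + y.2 by [].
have bil1 : bilinear_on (V `*` V) (fun x y => B1 x y.1).
  apply: bilinear_onD; first apply: bilinear_onD.
  - apply: bilinear_onM; exact: (bilinear_on_comp fstV fstL fstV fstL ips_bil).
  - exact: (bilinear_on_comp fstV fstL fstV fstL (b_phi_bilinear msh Vv)).
  - apply: bilinear_onM; exact: (bilinear_on_comp sndV sndL fstV fstL grad_bil).
have bil2 : bilinear_on (V `*` V) (fun x y => B2 x y.2).
  apply: bilinear_onD; first exact: (bilinear_on_comp sndV sndL sndV sndL ips_bil).
  apply: bilinear_onN; apply: bilinear_onM.
  exact: (bilinear_on_comp fstV fstL sndV sndL grad_bil).
have lin1 : linear_on V l1.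
  apply: linear_onD; last by apply: (ips_linear msh) => //; exact: integrable_on_meshZ.
  by apply: linear_onM; exact: ips_bil.2.
have lin2 : linear_on V l2.
  apply: linear_onD; apply: linear_onM; apply: (ips_linear msh) => //.
    exact: bounded_continuous_on_mesh.
  exact: bounded_continuous_on_mesh.
have linB1 x : (V `*` V) x -> linear_on V (B1 x).
  move=> [Vx1 Vx2]; apply: linear_onD; first apply: linear_onD.
  - by apply: linear_onM; exact: ips_bil.2.
  - exact: (b_phi_bilinear msh Vv).2.
  - by apply: linear_onM; exact: grad_bil.2.
have linB2 x : (V `*` V) x -> linear_on V (B2 x).
  move=> [Vx1 Vx2]; apply: linear_onD; first exact: ips_bil.2.
  by apply: linear_onN; apply: linear_onM; exact: grad_bil.2.
(* The two equations are recovered from their sum by setting one of the test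
   functions to zero. *)
apply: (@eq_exists_unique _ (fun x => (V `*` V) x /\
    forall y, (V `*` V) y -> B1 x y.1 + B2 x y.2 = l1 y.1 + l2 y.2)).
  case=> phi1 xi1; split.
    move=> [[V1 V2] BE]; split=> // th ch Vth Vch.
    have := BE (th, 0) (conj Vth sV.1); have := BE (0, ch) (conj sV.1 Vch).
    rewrite /= (linear_on0 sV lin1) (linear_on0 sV lin2) (linear_on0 sV (linB1 _ (conj V1 V2))).
    rewrite (linear_on0 sV (linB2 _ (conj V1 V2))) !add0r !addr0 => E2 E1.
    split; last exact: E2.
    rewrite ips_subl//; move: E1; rewrite /B1 /l1 /=.
    set p1 := ips omega phi1 th; set p2 := b_phi _ _ _ _; set p3 := ip _ _ _.
    by move=> E1; lra.
  move=> [V1 V2 BE]; split=> // -[th ch] [/= Vth Vch].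
  have [E1 E2] := BE th ch Vth Vch.
  by rewrite /= [B2 _ _]E2 /l1 -E1 ips_subl// /B1 /=; congr (_ + _); ring.
apply: variational_problem_wellposed.
- exact: pair_subspace.
- exact: pair_finitely_spanned.
- exact: bilinear_onD.
- apply: linear_onD; first exact: (linear_on_comp fstV fstL lin1).
  exact: (linear_on_comp sndV sndL lin2).
- move=> [ph xi] [/= V1 V2] B0; have Vx : (V `*` V) (ph, xi) by split.
  have := B0 (ph, 0) (conj V1 sV.1); have := B0 (0, xi) (conj sV.1 V2).
  rewrite /= (linear_on0 sV (linB1 _ Vx)).
  rewrite (linear_on0 sV (linB2 _ Vx)) add0r addr0 /B1 /B2/= (b_phi_skew msh Vv V1).
  rewrite (_ : ip omega (grad xi) (grad ph) = ip omega (grad ph) (grad xi)); last exact: ipC.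
  set G := ip _ _ _ => /eqP; rewrite subr_eq0 => /eqP xiE; rewrite addr0 => phE.
  have xi_ge0 := @ips_ge0 R omega xi; have ph_ge0 := @ips_ge0 R omega ph.
  have G_ge0 : 0 <= G by rewrite xiE pmulr_rge0 in xi_ge0.
  have dtph : 0 <= (prm_dt P)^-1 * ips omega ph ph by rewrite mulr_ge0// invr_ge0 ltW.
  have tauG : 0 <= prm_tau P * G by rewrite mulr_ge0// ltW.
  have ph0 : (prm_dt P)^-1 * ips omega ph ph = 0 by lra.
  have G0 : prm_tau P * G = 0 by lra.
  have {}G0 : G = 0 by move/eqP : G0; rewrite mulf_eq0 gt_eqF//= => /eqP.
  rewrite G0 mulr0 in xiE.
  have {}ph0 : ips omega ph ph = 0.
    by move/eqP : ph0; rewrite mulf_eq0 invr_eq0 gt_eqF//= => /eqP.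
  by rewrite (ips_eq0 msh V1 ph0) (ips_eq0 msh V2 xiE).
Qed.

Lemma ip_self_bilinear : bilinear_on WW (fun w z => ip omega w z).
Proof.
have Lid := linear_mxfield_Wvec msh.
exact: (ip_bilinear msh (Wvec_subspace omega T) Lid Lid).
Qed.

Lemma ipZl c w z : WW w -> WW z -> ip omega (fun x => c *: w x) z = c * ip omega w z.
Proof.
move=> Ww Wz.
exact: (linear_onZ c (Wvec_subspace omega T) (ip_self_bilinear.1 z Wz) Ww).
Qed.

Lemma ipZ_subl c w w' z : WW w -> WW w' -> WW z ->
  ip omega (fun x => c *: (w x - w' x)) z = c * ip omega w z - c * ip omega w' z.
Proof.
move=> Ww Ww' Wz; have [W0 WD] := Wvec_subspace omega T.
have bl := ip_self_bilinear.1 z Wz.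
have -> : (fun x => c *: (w x - w' x)) = c *: (- 1 *: w' + w).
  by apply/funext => x; rewrite -[RHS]/(c *: (- 1 *: w' x + w x)) scaleN1r addrC.
rewrite (linear_onZ c (Wvec_subspace omega T) bl); last exact: WD.
by rewrite bl// mulN1r mulrDr mulrN addrC.
Qed.

Lemma aux_wellposed v zeta (obs : R * R -> 'cV[R]_2) phi1 nu_min :
  0 <= nu_min -> (forall s, 0 <= s <= 1 -> nu_min <= prm_nu P s) ->
  VV v -> WW zeta -> V phi1 ->
  (forall k, integrable_on_mesh omega T (fun x => obs x k 0)) ->
  exists! zeta1, aux_solution omega T P v zeta obs phi1 zeta1.
Proof.
move=> numin0 nuP Vv Wzeta Vphi1 iobs.
have [_ [_ eps0 dt0] _ [_ [cnu _] _]] := adm.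
have sW := Wvec_subspace omega T.
have bnu : bounded_continuous Om0 (fun x => prm_nu P (hat phi1 x)).
  apply: comp_hat_bounded_continuous; last exact: Vh_bounded_continuous.
  exact: C1_line_continuous.
have LG := linear_mxfield_Grad msh.
pose B z th := (prm_dt P)^-1 * ip omega z th + transport omega v z th
  + prm_epsilon P * ip omega (fun x => prm_nu P (hat phi1 x) *: Grad z x) (Grad th).
pose l th := (prm_dt P)^-1 * ip omega zeta th
  + ip omega (fun x => prm_alpha_psi P *: obs x) th.
apply: (@eq_exists_unique _ (fun z => WW z /\ forall th, WW th -> B z th = l th)).
  move=> z; split=> -[Wz BE]; split=> // th Wth; have := BE th Wth; rewrite ipZ_subl//.
    move=> E; apply: (addIr ((prm_dt P)^-1 * ip omega zeta th)).
    by rewrite [RHS]addrC -[RHS]/(l th) -E /B; ring.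
  by rewrite /B /l => <-; ring.
apply: variational_problem_wellposed => //.
- exact: Wvec_finitely_spanned.
- apply: bilinear_onD; first apply: bilinear_onD.
  + exact: bilinear_onM ip_self_bilinear.
  + exact: (transport_bilinear msh sW (@subset_refl _ _) Vv).
  + apply: bilinear_onM; apply: (ip_bilinear msh sW) => //.
    exact: linear_mxfieldZ.
- apply: linear_onD; first by apply: linear_onM; exact: ip_self_bilinear.2.
  apply: (ip_linear msh sW); last exact: linear_mxfield_Wvec.
  move=> i j; rewrite ord1; under eq_fun do rewrite mxE.
  by apply: integrable_on_meshZ.
- move=> z Wz /(_ z Wz); rewrite /B (transport_self_eq0 msh)// addr0.
  have z0 : 0 <= (prm_dt P)^-1 * ip omega z z.
    by rewrite mulr_ge0 ?ip_self_ge0// invr_ge0 ltW.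
  have G0 : 0 <= prm_epsilon P * ip omega (fun x => prm_nu P (hat phi1 x) *: Grad z x) (Grad z).
    apply: mulr_ge0; first exact: ltW.
    apply: ip_weighted_ge0 => x.
    by rewrite (le_trans numin0)// nuP// truncation_bounds.
  move=> E; have {}z0 : (prm_dt P)^-1 * ip omega z z = 0 by lra.
  apply: (ip_eq0_Wvec msh) => //.
  by move/eqP : z0; rewrite mulf_eq0 invr_eq0 gt_eqF//= => /eqP.
Qed.

(** The Darcy term is nonnegative because the truncated phase is at most [1]. *)
Lemma NS_wellposed v pi pi_ (obs : R * R -> 'cV[R]_2) phi1 xi1 zeta1 eta_min kappa_min :
  0 < eta_min -> 0 < kappa_min ->
  (forall s, 0 <= s <= 1 -> eta_min <= prm_eta P s /\ kappa_min <= prm_kappa P s) ->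
  VV v -> V pi -> V pi_ -> V phi1 -> V xi1 -> WW zeta1 ->
  (forall k, integrable_on_mesh omega T (fun x => obs x k 0)) ->
  exists! v1, NS_solution omega T P v pi pi_ obs phi1 xi1 zeta1 v1.
Proof.
move=> eta0 kap0 ekP Vv Vpi Vpi_ Vphi1 Vxi1 Wzeta1 iobs.
have [[rho0 Re0 _ _] [_ _ dt0] _ [[ceta _] [cnu _] [ckap _]]] := adm.
have sX := Vvec_subspace omega T; have [Wv _] := Vv.
have VW : VV `<=` WW by move=> w [].
have hatP x : 0 <= hat phi1 x <= 1 by exact: truncation_bounds.
have [eta_ge kap_ge] : (forall x, eta_min <= prm_eta P (hat phi1 x)) /\
    (forall x, kappa_min <= prm_kappa P (hat phi1 x)).
  by split=> x; have [] := ekP _ (hatP x).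
have bphi1 := Vh_bounded_continuous msh Vphi1.
have bcoef g : C1_line g -> bounded_continuous Om0 (fun x => g (hat phi1 x)).
  by move=> /C1_line_continuous cg; exact: comp_hat_bounded_continuous.
have beta := bcoef _ ceta; have bnu := bcoef _ cnu; have bkap := bcoef _ ckap.
have bdnu : bounded_continuous Om0 (fun x => derive1 (prm_nu P) (hat phi1 x)).
  by apply: comp_hat_bounded_continuous => //; case: cnu.
have bdarcy : bounded_continuous Om0
    (fun x => prm_eta P (hat phi1 x) / prm_kappa P (hat phi1 x) * (1 - hat phi1 x)).
  apply: bounded_continuousM.
    by apply: bounded_continuousM => //; apply: (bounded_continuousV kap0) => // x _.
  apply: bounded_continuousD; first exact: bounded_continuous_cst.
  by apply: bounded_continuousN; exact: hat_bounded_continuous.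
have bG := Grad_bounded_continuous msh Wzeta1.
have bgrad := grad_bounded_continuous msh Vphi1.
have LW : linear_mxfield omega T VV id by exact: linear_mxfieldS VW (linear_mxfield_Wvec msh).
have LG : linear_mxfield omega T VV Grad by exact: linear_mxfieldS VW (linear_mxfield_Grad msh).
have bcst c : bounded_continuous Om0 (fun=> c) by exact: bounded_continuous_cst.
have lin A : bounded_continuous_mx omega T A -> linear_on VV (fun w => ip omega A w).
  move=> bA; apply: (ip_linear msh sX) LW => i j.
  by apply: bounded_continuous_on_mesh => //; exact: bA.
pose k := prm_rho P * prm_Reynolds P / prm_dt P.
pose B w z := ip omega (fun x => k *: w x) z
      + prm_rho P * prm_Reynolds P * transport omega v w z
      + ip omega (fun x => prm_eta P (hat phi1 x) *: Grad w x) (Grad z)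
      + ip omega (fun x => (prm_eta P (hat phi1 x) / prm_kappa P (hat phi1 x)
                            * (1 - hat phi1 x)) *: w x) z.
apply: (@variational_problem_wellposed _ _ VV B) => //.
- by apply: finitely_spannedS VW _; exact: Wvec_finitely_spanned.
- apply: bilinear_onD; first apply: bilinear_onD; first apply: bilinear_onD.
  + by apply: (ip_bilinear msh sX) => //; apply: (linear_mxfieldZ (bcst k)).
  + by apply: bilinear_onM; exact: (transport_bilinear msh sX VW Vv).
  + by apply: (ip_bilinear msh sX) => //; exact: linear_mxfieldZ.
  + by apply: (ip_bilinear msh sX) => //; exact: linear_mxfieldZ bdarcy LW.
- apply: linear_onD; first apply: linear_onD; first apply: linear_onD;
    first apply: linear_onD; first apply: linear_onD.
  + apply: lin; apply: (bounded_continuous_mxZ (bcst k)).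
    exact: Wvec_bounded_continuous.
  + apply: (ips_linear msh).
      apply: bounded_continuous_on_mesh => //; apply: bounded_continuousD.
        by apply: bounded_continuousM => //; exact: Vh_bounded_continuous.
      by apply: bounded_continuousN; exact: Vh_bounded_continuous.
    exact: linear_fieldS VW (linear_field_div msh).
  + by apply: lin; apply: bounded_continuous_mxZ => //; exact: Vh_bounded_continuous.
  + apply: linear_onN; apply: linear_onM; apply: lin; apply: bounded_continuous_mxZ => //.
    by apply: bounded_continuousM => //; exact: bounded_continuous_dot.
  + apply: linear_onN; apply: (ip_linear msh sX) LG => i j.
    apply: bounded_continuous_on_mesh => //; apply: bounded_continuous_mxZ => //.
    apply: bounded_continuous_mxM => // a b.
    by under eq_fun do rewrite mxE; exact: bG.
  + apply: (ip_linear msh sX) LW => i j; rewrite ord1; under eq_fun do rewrite mxE.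
    exact: integrable_on_meshZ.
- move=> w Vw /(_ w Vw); have Ww := VW _ Vw.
  rewrite /B (transport_self_eq0 msh)// mulr0 addr0 ipZl//.
  have k0 : 0 < k by rewrite divr_gt0// mulr_gt0.
  have w0 : 0 <= k * ip omega w w by rewrite mulr_ge0 ?ip_self_ge0// ltW.
  have G0 : 0 <= ip omega (fun x => prm_eta P (hat phi1 x) *: Grad w x) (Grad w).
    by apply: ip_weighted_ge0 => x; rewrite (le_trans (ltW eta0)).
  have D0 : 0 <= ip omega (fun x => (prm_eta P (hat phi1 x) / prm_kappa P (hat phi1 x)
                            * (1 - hat phi1 x)) *: w x) w.
    apply: ip_weighted_ge0 => x; rewrite mulr_ge0//.
      by apply: divr_ge0; [exact: le_trans (ltW eta0) _|exact: le_trans (ltW kap0) _].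
    by rewrite subr_ge0; case/andP: (hatP x).
  move=> E; have {}w0 : k * ip omega w w = 0 by lra.
  apply: (ip_eq0_Wvec msh) => //.
  by move/eqP : w0; rewrite mulf_eq0 gt_eqF//= => /eqP.
Qed.

Lemma mean_linear : linear_on V (fun q => \int[area]_(x in omega) q x).
Proof.
have i1 : integrable_on_mesh omega T (fun=> 1).
  by apply: bounded_continuous_on_mesh => //; exact: bounded_continuous_cst.
apply: eq_linear_on sV _ _ _ (ips_linear msh i1 (linear_field_id msh)) => q _.
by apply: eq_Rintegral => x _; rewrite mul1r.
Qed.

Lemma Qh0_sub_Vh : Q0 `<=` V.
Proof. by move=> q [Qq _]; exact: Qh_sub_Vh. Qed.

Lemma Qh0_subspace : subspace_of Q0.
Proof.
have [Q00 QD] := fe_space_subspace omega T 1; split.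
  by split=> //; exact: linear_on0 sV mean_linear.
move=> a p q Qp Qq; split; first by apply: QD; [case: Qp|case: Qq].
rewrite mean_linear; [|exact: Qh0_sub_Vh..].
by case: Qp => _ ->; case: Qq => _ ->; rewrite mulr0 addr0.
Qed.

(** In the kernel the gradient vanishes off the skeleton, so the function is a
    constant, which the mean value condition forces to be zero. *)
Lemma pressure_wellposed pi v1 : V pi -> WW v1 ->
  exists! pi1, pressure_solution omega T P pi v1 pi1.
Proof.
move=> Vpi Wv1; have sQ := Qh0_subspace.
have Lg : linear_mxfield omega T Q0 grad.
  exact: linear_mxfieldS Qh0_sub_Vh (linear_mxfield_grad msh).
have Lid : linear_field omega T Q0 id.
  exact: linear_fieldS Qh0_sub_Vh (linear_field_id msh).
apply: (@variational_problem_wellposed _ _ Q0 (fun p q => ip omega (grad p) (grad q))) => //.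
- exact: finitely_spannedS Qh0_sub_Vh fV.
- exact: (ip_bilinear msh sQ).
- apply: linear_onD.
    apply: (ips_linear msh) => //; apply: bounded_continuous_on_mesh => //.
    apply: bounded_continuousM; first exact: bounded_continuous_cst.
    exact: div_bounded_continuous.
  apply: linear_onN; apply: (ip_linear msh sQ) => // i j.
  by apply: bounded_continuous_on_mesh => //; exact: grad_bounded_continuous.
- move=> q Qq /(_ q Qq) q0; have Vq := Qh0_sub_Vh Qq; have [Qhq mq] := Qq.
  have g0 := ip_self_eq0 msh (grad_bounded_continuous msh Vq) q0.
  have [c qc] : exists c, forall x, omega x -> q x = c.
    apply: (fe1_grad_eq0_cst msh Qhq) => x j Ox.
    by have := congr1 (fun A : 'cV[R]_2 => A j 0) (g0 x Ox); rewrite !mxE.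
  suff c0 : c = 0.
    by apply: (@fe_eq0 _ _ _ _ msh 1 q Qhq) => x [Ox _]; rewrite qc.
  have mO := measurable_open_bounded (open_off_skeleton msh) (bounded_off_skeleton msh).
  have /andP[a0 aoo] := area_off_skeleton msh.
  move: mq; rewrite (Rintegral_off_skeleton msh).
  have -> : \int[area]_(x in Om0) q x = \int[area]_(x in Om0) c.
    by apply: eq_Rintegral => x /[!inE] -[Ox _]; exact: qc.
  rewrite Rintegral_cst; last by case: mO.
  move/eqP; rewrite mulf_eq0 => /orP[/eqP//|].
  by rewrite gt_eqF// fine_gt0// a0.
Qed.

End Steps.

(** * One time step *)

Theorem theorem3p1 (R : realType)
  (omega : set (R * R)) (N : nat) (T : 'I_N -> R * R -> R * R)
  (P : parameters R) (q Cf cF CF : R)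
  (c0 delta : R) (dom : set (R * R -> R)) (IH : (R * R -> R) -> R * R -> R)
  (eta_min eta_max nu_min nu_max kappa_min kappa_max : R)
  (u psi : R * R -> 'cV[R]_2) (phi : R * R -> R)
  (v_h : R * R -> 'cV[R]_2) (pi_h pi_h_prev phi_h : R * R -> R)
  (zeta_h : R * R -> 'cV[R]_2) :
  bounded_simply_connected_domain omega ->
  conforming_triangulation omega T ->
  boundary_assumption omega T ->
  admissible_parameters P ->
  3 <= q -> 0 < Cf -> 0 < cF -> 0 <= CF -> potential (prm_F P) q Cf cF CF ->
  0 < c0 -> 0 < delta -> observation_operator omega c0 delta dom IH ->
  0 < eta_min -> 0 <= nu_min -> 0 < kappa_min ->
  (forall s, 0 <= s <= 1 ->
    [/\ eta_min <= prm_eta P s <= eta_max, nu_min <= prm_nu P s <= nu_max &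
        kappa_min <= prm_kappa P s <= kappa_max]) ->
  Vvec omega T v_h -> Qh0 omega T pi_h -> Qh0 omega T pi_h_prev ->
  Vh omega T phi_h -> Wvec omega T zeta_h ->
  let d_phi := fun x => phi x - phi_h x in
  let d_psi := fun x => psi x - zeta_h x in
  let d_u := fun x => u x - v_h x in
  dom d_phi -> L2 omega (IH d_phi) ->
  (forall k, dom (fun x => d_psi x k 0)) -> L2v omega (IHv IH d_psi) ->
  (forall k, dom (fun x => d_u x k 0)) -> L2v omega (IHv IH d_u) ->
  let CH := CH_solution omega T P v_h phi_h zeta_h (IH d_phi) in
  let AUX := aux_solution omega T P v_h zeta_h (IHv IH d_psi) in
  let NS := NS_solution omega T P v_h pi_h pi_h_prev (IHv IH d_u) in
  let PR := pressure_solution omega T P pi_h in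
  [/\ exists! sol, CH sol,
      forall phi1 xi1, CH (phi1, xi1) -> exists! zeta1, AUX phi1 zeta1,
      forall phi1 xi1 zeta1, CH (phi1, xi1) -> AUX phi1 zeta1 ->
        exists! v1, NS phi1 xi1 zeta1 v1 &
      forall phi1 xi1 zeta1 v1, CH (phi1, xi1) -> AUX phi1 zeta1 ->
        NS phi1 xi1 zeta1 v1 -> exists! pi1, PR v1 pi1].
Proof.
move=> [bO oO nO cO _] tri _ adm _ _ _ _ potF _ _ _ eta0 nu0 kap0 bounds.
move=> Vv Qpi Qpi_ Vphi Wzeta d_phi d_psi d_u _ Lphi _ Lpsi _ Lu CH AUX NS PR.
have msh : triangulated_domain omega T by [].
have ctF : continuous (derive1 (prm_F P)).
  by have [[_ /C1_line_continuous]] := potF.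
have L2v_int (a : R * R -> 'cV[R]_2) : L2v omega a ->
    forall k, integrable_on_mesh omega T (fun x => a x k 0).
  by move=> La k; exact: (L2_integrable_on_mesh msh (La k)).
have Wv : Wvec omega T v_h by case: Vv.
split.
- exact: (CH_wellposed msh adm ctF Vv Vphi Wzeta (L2_integrable_on_mesh msh Lphi)).
- move=> phi1 xi1 [Vphi1 _ _].
  apply: (aux_wellposed msh adm nu0 _ Vv Wzeta Vphi1 (L2v_int _ Lpsi)) => s s01.
  by have [_ /andP[]] := bounds s s01.
- move=> phi1 xi1 zeta1 [Vphi1 Vxi1 _] [Wzeta1 _].
  apply: (NS_wellposed msh adm eta0 kap0 _ Vv (Qh0_sub_Vh Qpi) (Qh0_sub_Vh Qpi_)
    Vphi1 Vxi1 Wzeta1 (L2v_int _ Lu)) => s s01.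
  by have [/andP[? _] _ /andP[? _]] := bounds s s01.
- move=> phi1 xi1 zeta1 v1 _ _ [[Wv1 _] _].
  exact: (pressure_wellposed msh P (Qh0_sub_Vh Qpi) Wv1).
Qed.
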